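(* Let $\gamma\subset\mathbb{R}^2$ be a smooth, strictly convex, closed curve, let $A_n$ be the maximal area of a simple $n$-gon inscribed in $\gamma$, and let $a_0,a_1$ be the first two coefficients of the asymptotic expansion $$A_n\sim a_0+\frac{a_1}{n^2}+\frac{a_2}{n^4}+\cdots\qquad (n\to\infty).$$ Then $a_0$ and $a_1$ make it possible to recognize an ellipse: one always has $$-3a_1\le 2\pi^2 a_0,$$ with equality if and only if $\gamma$ is an ellipse.
   Context: $A_n$ is the maximal action among simple $n$-periodic polygons of the symplectic billiard in $\gamma$, i.e. the maximal area of a simple $n$-gon with vertices on $\gamma$. It is known that, as $n\to\infty$, $A_n$ has an asymptotic expansion in negative even powers of $n$, as displayed; $a_0$ is the area bounded by $\gamma$, and $|a_1|=L^3/12$, where $L=\int_\gamma \kappa^{1/3}\,ds$ is the affine length of $\gamma$ ($\kappa$ the Euclidean curvature, $s$ the arc length). *)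

(* Defs.v *)
(* Stdlib reals and Coquelicot. *)
From Stdlib Require Import Reals Arith Lra.
From Coquelicot Require Import Coquelicot.
Open Scope R_scope.

Definition point : Type := (R * R)%type.

Definition vec (p q : point) : point := (fst q - fst p, snd q - snd p).

Definition cross (u v : point) : R := fst u * snd v - snd u * fst v.

(** * Curves, as subsets of the plane *)

Definition smooth (f : R -> R) : Prop :=
  forall (k : nat) (t : R), ex_derive_n f k t.

Definition velocity (c : R -> point) (t : R) : point :=
  (Derive (fun s => fst (c s)) t, Derive (fun s => snd (c s)) t).

Definition simple_closed_smooth_param (c : R -> point) (T : R) : Prop :=
  0 < T /\
  smooth (fun t => fst (c t)) /\ smooth (fun t => snd (c t)) /\
  (forall t, velocity c t <> (0, 0)) /\
  (forall t, c (t + T) = c t) /\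
  (forall s t, 0 <= s < T -> 0 <= t < T -> c s = c t -> s = t).

(* Apart from the point of contact, the curve lies strictly on one side of each
   of its tangent lines.  The curvature may vanish at some points, and either
   orientation of the parametrization is allowed. *)
Definition strictly_convex_param (c : R -> point) : Prop :=
  forall s,
    (forall t, c t <> c s -> 0 < cross (velocity c s) (vec (c s) (c t))) \/
    (forall t, c t <> c s -> cross (velocity c s) (vec (c s) (c t)) < 0).

Definition smooth_strictly_convex_closed_curve (g : point -> Prop) : Prop :=
  exists (c : R -> point) (T : R),
    simple_closed_smooth_param c T /\
    strictly_convex_param c /\
    (forall p, g p <-> exists t, c t = p).

(* Centre m, semi-axes a and b, the axis of length 2a making the angle th with
   the first coordinate axis. *)
Definition is_ellipse (g : point -> Prop) : Prop :=
  exists (m : point) (th a b : R),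
    0 < a /\ 0 < b /\
    forall p, g p <->
      ((cos th * fst (vec m p) + sin th * snd (vec m p)) / a) ^ 2 +
      ((- sin th * fst (vec m p) + cos th * snd (vec m p)) / b) ^ 2 = 1.

(** * Inscribed polygons *)

(* An n-gon is given by its cyclically ordered vertices v 0, ..., v (n-1); the
   values of v at indices >= n play no role. *)
Definition next (n i : nat) : nat := (S i mod n)%nat.

Definition edge_point (n : nat) (v : nat -> point) (i : nat) (s : R) : point :=
  (fst (v i) + s * fst (vec (v i) (v (next n i))),
   snd (v i) + s * snd (vec (v i) (v (next n i)))).

(* The closed polygonal line through the vertices does not meet itself; the
   edges are half-open so that consecutive ones may share a vertex. *)
Definition simple_polygon (n : nat) (v : nat -> point) : Prop :=
  forall (i j : nat) (s t : R),
    (i < n)%nat -> (j < n)%nat -> 0 <= s < 1 -> 0 <= t < 1 ->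
    edge_point n v i s = edge_point n v j t -> i = j /\ s = t.

Definition inscribed (g : point -> Prop) (n : nat) (v : nat -> point) : Prop :=
  forall i, (i < n)%nat -> g (v i).

(* Shoelace formula: the area enclosed by a simple polygon, and up to
   orientation its symplectic action. *)
Definition polygon_area (n : nat) (v : nat -> point) : R :=
  Rabs (sum_n (fun i => cross (v i) (v (next n i))) (pred n)) / 2.

Definition is_max_inscribed_area (g : point -> Prop) (n : nat) (A : R) : Prop :=
  (exists v, simple_polygon n v /\ inscribed g n v /\ polygon_area n v = A) /\
  (forall v, simple_polygon n v -> inscribed g n v -> polygon_area n v <= A).

(** * Asymptotic expansions *)

(* A n ~ a 0 + a 1 / n^2 + a 2 / n^4 + ... in the sense of Poincare: the error
   of the partial sum up to a N / n^(2N) is o(1 / n^(2N)), for every N. *)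
Definition even_asymptotic_expansion (A a : nat -> R) : Prop :=
  forall N : nat,
    is_lim_seq
      (fun n => INR n ^ (2 * N) *
                (A n - sum_n (fun k => a k / INR n ^ (2 * k)) N))
      0.

(* Main.v *)
(* Following Sas, parametrize the curve as P(th) = (m + r cos th, f(th)) and average the
   area of the inscribed n-gon with vertices P(th + 2 pi k / n) over th: the result is
   (n / 2 pi) sin (2 pi / n) times the enclosed area a0, whence a1 >= - (2 pi^2 / 3) a0.
   More generally, for (X(u), Y(u)) = P(q(u)), the average over u is the integral of
   Y(u) (X(u - h) - X(u + h)), and an expansion in h bounds a1 from below by a multiple of
   the integral of Y X''', where only X has to be smooth.  In case of equality the choice
   q = id is optimal among all reparametrizations of the circle; the first variation in the
   directions q' = 1 + e cos (k q + al) shows that all Fourier coefficients of f of order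
   at least 2 vanish, so that P is an affine image of the circle.  For an ellipse, A_n is
   computed exactly. *)
Require Import Defs.
From Stdlib Require Import Reals ZArith Lra Lia Psatz ClassicalEpsilon.
From Coquelicot Require Import Coquelicot.
Open Scope R_scope.

(** * Calculus and inscribed polygons *)

(** The constant comes from [X''' = - X'] for a cosine abscissa: the integral of [Y X'''] is then
    the enclosed area itself, so the second-order term of the averages is a multiple of [a0]. The
    coefficients are reached only through inequalities on [A n]. The enclosed area bounds every
    inscribed polygon from above and the averages from below tend to it, which pins [a0]; a bound on
    [a1] is then read off at order [1 / n ^ 2]. The upper bound concerns arbitrary simple polygons,
    whose vertices could a priori visit the curve in any order, so simplicity must first be shown to
    force the cyclic order. The ordinate over a cosine abscissa can fail to be smooth where the
    tangent is vertical, since the curvature may vanish there. Hence [f] is only known to be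
    continuous, and convexity is restated without derivatives. The first variation determines [f]
    because it couples just the frequencies [k - 1] and [k + 1], with a factor on the lower one that
    vanishes for the frequencies 0 and 1. *)

Lemma continuous_Rplus (f g : R -> R) (x : R) :
  continuous f x -> continuous g x -> continuous (fun t => f t + g t) x.
Proof. intros; now apply (continuous_plus f g). Qed.

Lemma continuous_Rminus (f g : R -> R) (x : R) :
  continuous f x -> continuous g x -> continuous (fun t => f t - g t) x.
Proof. intros; now apply (continuous_minus f g). Qed.

Lemma continuous_Ropp (f : R -> R) (x : R) :
  continuous f x -> continuous (fun t => - f t) x.
Proof. intros; now apply (continuous_opp f). Qed.

Lemma continuous_Rmult (f g : R -> R) (x : R) :
  continuous f x -> continuous g x -> continuous (fun t => f t * g t) x.
Proof. intros; now apply (continuous_mult f g). Qed.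

Ltac cont :=
  repeat match goal with
  | |- continuous (fun _ => ?a) _ => apply continuous_const
  | |- continuous (fun t => t) _ => apply continuous_id
  | |- continuous (fun t => @?f t + @?g t) _ => apply (continuous_Rplus f g)
  | |- continuous (fun t => @?f t - @?g t) _ => apply (continuous_Rminus f g)
  | |- continuous (fun t => - @?f t) _ => apply (continuous_Ropp f)
  | |- continuous (fun t => @?f t * @?g t) _ => apply (continuous_Rmult f g)
  | |- continuous (fun t => cos (@?g t)) _ => apply (continuous_comp g cos); [|apply continuous_cos]
  | |- continuous (fun t => sin (@?g t)) _ => apply (continuous_comp g sin); [|apply continuous_sin]
  | H : forall t, continuous ?f t |- continuous ?f _ => apply H
  | H : forall t, continuous ?f t |- continuous (fun t => ?f t) _ => apply H
  | H : forall t, continuous (fun s => fst (?f s)) t |- continuous (fun t => fst (?f (@?g t))) _ =>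
      apply (continuous_comp g (fun s => fst (f s))); [|apply H]
  | H : forall t, continuous (fun s => snd (?f s)) t |- continuous (fun t => snd (?f (@?g t))) _ =>
      apply (continuous_comp g (fun s => snd (f s))); [|apply H]
  | H : forall t, continuous ?f t |- continuous (fun t => ?f (@?g t)) _ =>
      apply (continuous_comp g f); [|apply H]
  end.

Lemma is_derive_Rplus (f g : R -> R) (x df dg : R) : is_derive f x df -> is_derive g x dg ->
  is_derive (fun t => f t + g t) x (df + dg).
Proof. intros; now apply (is_derive_plus f g). Qed.

Lemma is_derive_Rminus (f g : R -> R) (x df dg : R) : is_derive f x df -> is_derive g x dg ->
  is_derive (fun t => f t - g t) x (df - dg).
Proof. intros; now apply (is_derive_minus f g). Qed.

Lemma is_derive_Ropp (f : R -> R) (x df : R) : is_derive f x df ->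
  is_derive (fun t => - f t) x (- df).
Proof. intros; now apply (is_derive_opp f). Qed.

Lemma is_derive_Rmult (f g : R -> R) (x df dg : R) : is_derive f x df -> is_derive g x dg ->
  is_derive (fun t => f t * g t) x (df * g x + f x * dg).
Proof. intros; apply (is_derive_mult f g); auto; intros; apply Rmult_comm. Qed.

Lemma is_derive_Rconst (k x : R) : is_derive (fun _ : R => k) x 0.
Proof. apply (is_derive_const (V := R_NormedModule)). Qed.

Lemma is_derive_Rid (x : R) : is_derive (fun t : R => t) x 1.
Proof. apply (is_derive_id (K := R_AbsRing)). Qed.

Lemma is_derive_Rcomp (f g : R -> R) (x df dg : R) : is_derive f (g x) df -> is_derive g x dg ->
  is_derive (fun t => f (g t)) x (df * dg).
Proof.
intros Hf Hg; evar_last; [apply (is_derive_comp f g); eassumption|].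
apply Rmult_comm.
Qed.

(** The computed derivative is syntactic; the calls are placed under [evar_last], which leaves its
    comparison with the expected expression to [ring]. *)
Ltac deriv :=
  repeat match goal with
  | |- is_derive (fun _ => ?a) _ _ => apply is_derive_Rconst
  | |- is_derive (fun t => t) _ _ => apply is_derive_Rid
  | |- is_derive (fun t => @?f t + @?g t) _ _ => apply (is_derive_Rplus f g)
  | |- is_derive (fun t => @?f t - @?g t) _ _ => apply (is_derive_Rminus f g)
  | |- is_derive (fun t => - @?f t) _ _ => apply (is_derive_Ropp f)
  | |- is_derive (fun t => @?f t * @?g t) _ _ => apply (is_derive_Rmult f g)
  | |- is_derive (fun t => cos (@?g t)) _ _ => apply (is_derive_Rcomp cos g); [apply is_derive_cos|]
  | |- is_derive (fun t => sin (@?g t)) _ _ => apply (is_derive_Rcomp sin g); [apply is_derive_sin|]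
  | H : forall t, is_derive ?f t _ |- is_derive ?f _ _ => apply H
  | H : forall t, is_derive ?f t _ |- is_derive (fun t => ?f t) _ _ => apply H
  | H : forall t, is_derive ?f t _ |- is_derive (fun t => ?f (@?g t)) _ _ =>
      apply (is_derive_Rcomp f g); [apply H|]
  end.

Lemma continuous_zero_between (f : R -> R) (a b : R) :
  (forall t, continuous f t) -> f a * f b <= 0 ->
  exists z, Rmin a b <= z <= Rmax a b /\ f z = 0.
Proof.
intros Hf Hab.
assert (C : continuity f).
{ intros t; apply continuity_pt_filterlim, Hf. }
destruct (Rle_dec a b) as [L|L].
- destruct (IVT_cor f a b C L Hab) as [z Hz].
  exists z; rewrite Rmin_left, Rmax_right; lra.
- destruct (IVT_cor f b a C) as [z Hz]; try lra.
  exists z; rewrite Rmin_right, Rmax_left; lra.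
Qed.

(** * Ovals, convex position and simplicity *)

Definition orient (p q r : point) : R := cross (vec p q) (vec p r).

(** Convexity without derivatives: three points within one period are never collinear. This makes
    sense for parametrizations whose ordinate is merely continuous. *)
Definition oval (c : R -> point) (T : R) : Prop :=
  0 < T /\
  (forall t, continuous (fun s => fst (c s)) t) /\
  (forall t, continuous (fun s => snd (c s)) t) /\
  (forall t, c (t + T) = c t) /\
  (forall r s t, r < s -> s < t -> t < r + T -> orient (c r) (c s) (c t) <> 0).

(* The triples [r < s < t < r + T] form a convex, hence connected, set. *)
Lemma oval_orient_sign (c : R -> point) (T : R) : oval c T ->
  exists e, (e = 1 \/ e = -1) /\
    forall r s t, r < s -> s < t -> t < r + T ->
      0 < e * orient (c r) (c s) (c t).
Proof.
intros (HT & Cx & Cy & _ & NZ).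
assert (B : orient (c 0) (c (T / 3)) (c (2 * T / 3)) <> 0) by (apply NZ; lra).
assert (same : forall r s t, r < s -> s < t -> t < r + T ->
  0 < orient (c 0) (c (T / 3)) (c (2 * T / 3)) * orient (c r) (c s) (c t)).
{ intros r s t H1 H2 H3.
  apply Rnot_le_lt; intros H.
  set (F := fun l => orient (c ((1 - l) * 0 + l * r))
     (c ((1 - l) * (T / 3) + l * s)) (c ((1 - l) * (2 * T / 3) + l * t))).
  destruct (continuous_zero_between F 0 1) as (l & Hl & E).
  - intros l; unfold F, orient, cross, vec; cbn [fst snd]; cont.
  - unfold F.
    replace ((1 - 0) * 0 + 0 * r) with 0 by ring.
    replace ((1 - 0) * (T / 3) + 0 * s) with (T / 3) by ring.
    replace ((1 - 0) * (2 * T / 3) + 0 * t) with (2 * T / 3) by ring.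
    replace ((1 - 1) * 0 + 1 * r) with r by ring.
    replace ((1 - 1) * (T / 3) + 1 * s) with s by ring.
    replace ((1 - 1) * (2 * T / 3) + 1 * t) with t by ring.
    exact H.
  - rewrite Rmin_left, Rmax_right in Hl by lra.
    revert E; apply NZ; nra. }
destruct (Rlt_dec 0 (orient (c 0) (c (T / 3)) (c (2 * T / 3)))) as [P|P].
- exists 1; split; [now left|]; intros r s t H1 H2 H3.
  specialize (same r s t H1 H2 H3); nra.
- exists (-1); split; [now right|]; intros r s t H1 H2 H3.
  specialize (same r s t H1 H2 H3); nra.
Qed.

Lemma orient_rotate (p q r : point) : orient p q r = orient q r p.
Proof. unfold orient, cross, vec; cbn [fst snd]; ring. Qed.

Lemma next_lt (n i : nat) : (S i < n)%nat -> next n i = S i.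
Proof. intros H; unfold next; now apply Nat.mod_small. Qed.

Lemma next_last (n i : nat) : S i = n -> next n i = 0%nat.
Proof. intros <-; unfold next; apply Nat.Div0.mod_same. Qed.

Lemma next_cases (n i : nat) : (i < n)%nat ->
  ((S i < n)%nat /\ next n i = S i) \/ (S i = n /\ next n i = 0%nat).
Proof.
intros H; destruct (Nat.eq_dec (S i) n) as [E|E].
- right; split; [exact E|now apply next_last].
- left; assert (L : (S i < n)%nat) by lia; split; [exact L|now apply next_lt].
Qed.

Lemma orient_edge_point (n : nat) (v : nat -> point) (p q : point) (j : nat) (t : R) :
  orient p q (edge_point n v j t) =
  (1 - t) * orient p q (v j) + t * orient p q (v (next n j)).
Proof. unfold orient, edge_point, cross, vec; cbn [fst snd]; ring. Qed.

(** A point common to the edges [i] and [j] lies on the line of edge [i], whereas [v j] has the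
    positive weight [1 - t] and lies strictly on one side unless [j] is [i] or its successor. Two
    distinct meeting edges would thus be successors of each other, impossible for three or more
    vertices. For a single edge, a vertex off its line shows that the edge is not degenerate. *)
Lemma convex_polygon_simple (n : nat) (v : nat -> point) (e : R) : (3 <= n)%nat ->
  (forall i j, (i < n)%nat -> (j < n)%nat -> j <> i -> j <> next n i ->
     0 < e * orient (v i) (v (next n i)) (v j)) ->
  simple_polygon n v.
Proof.
intros Hn H.
assert (H0 : forall i j, (i < n)%nat -> (j < n)%nat ->
     0 <= e * orient (v i) (v (next n i)) (v j)).
{ intros i j Hi Hj.
  destruct (Nat.eq_dec j i) as [->|N1].
  { apply Req_le; unfold orient, cross, vec; cbn [fst snd]; ring. }
  destruct (Nat.eq_dec j (next n i)) as [->|N2].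
  { apply Req_le; unfold orient, cross, vec; cbn [fst snd]; ring. }
  now apply Rlt_le, H. }
assert (nx : forall i, (i < n)%nat -> (next n i < n)%nat).
{ intros i Hi; destruct (next_cases n i Hi) as [[? ->]|[? ->]]; lia. }
assert (key : forall i j s t, (i < n)%nat -> (j < n)%nat -> 0 <= s < 1 -> 0 <= t < 1 ->
  edge_point n v i s = edge_point n v j t -> j <> i -> j = next n i).
{ intros i j s t Hi Hj Hs Ht E N.
  destruct (Nat.eq_dec j (next n i)) as [?|N2]; [assumption|exfalso].
  assert (E2 : e * orient (v i) (v (next n i)) (edge_point n v j t) = 0).
  { rewrite <- E, orient_edge_point.
    unfold orient, cross, vec; cbn [fst snd]; ring. }
  rewrite orient_edge_point in E2.
  pose proof (H i j Hi Hj N N2).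
  pose proof (H0 i (next n j) Hi (nx j Hj)).
  nra. }
intros i j s t Hi Hj Hs Ht E.
destruct (Nat.eq_dec j i) as [->|N].
- split; [reflexivity|].
  destruct (Req_dec s t) as [?|Nst]; [assumption|exfalso].
  assert (K : exists k, (k < n)%nat /\ k <> i /\ k <> next n i).
  { destruct (Nat.eq_dec 0 i) as [A0|A0], (Nat.eq_dec 0 (next n i)) as [B0|B0],
      (Nat.eq_dec 1 i) as [A1|A1], (Nat.eq_dec 1 (next n i)) as [B1|B1];
    first [exists 0%nat; lia | exists 1%nat; lia | exists 2%nat; lia]. }
  destruct K as (k & Hk & K1 & K2).
  pose proof (H i k Hi Hk K1 K2) as P.
  unfold edge_point, vec in E; cbn [fst snd] in E.
  injection E as E1 E2.
  assert (Z1 : fst (v (next n i)) - fst (v i) = 0).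
  { apply Rmult_eq_reg_l with (s - t); [|lra]; lra. }
  assert (Z2 : snd (v (next n i)) - snd (v i) = 0).
  { apply Rmult_eq_reg_l with (s - t); [|lra]; lra. }
  unfold orient, cross, vec in P; cbn [fst snd] in P.
  rewrite Z1, Z2 in P; lra.
- exfalso.
  pose proof (key i j s t Hi Hj Hs Ht E N) as K1.
  pose proof (key j i t s Hj Hi Ht Hs (eq_sym E) (not_eq_sym N)) as K2.
  destruct (next_cases n i Hi) as [[? R1]|[? R1]],
    (next_cases n j Hj) as [[? R2]|[? R2]]; lia.
Qed.

Lemma oval_polygon_simple (c : R -> point) (T : R) (n : nat) (s : nat -> R) :
  oval c T -> (3 <= n)%nat ->
  (forall i j, (i < j)%nat -> (j < n)%nat -> s i < s j) ->
  (forall i, (i < n)%nat -> s i < s 0%nat + T) ->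
  simple_polygon n (fun i => c (s i)).
Proof.
intros O Hn Hs HT.
destruct (oval_orient_sign c T O) as (e & _ & He).
assert (Hs0 : forall i, (i < n)%nat -> s 0%nat <= s i).
{ intros [|i] Hi; [lra|]; apply Rlt_le, Hs; lia. }
apply convex_polygon_simple with e; [exact Hn|].
intros i j Hi Hj N1 N2.
destruct (next_cases n i Hi) as [[L E]|[L E]]; rewrite E in N2 |- *.
- destruct (Nat.lt_ge_cases j i) as [Lt|Ge].
  + rewrite orient_rotate, orient_rotate.
    apply He; [apply Hs; lia|apply Hs; lia|].
    pose proof (HT (S i) L); pose proof (Hs0 j Hj); lra.
  + apply He; [apply Hs; lia|apply Hs; lia|].
    pose proof (HT j Hj); pose proof (Hs0 i Hi); lra.
- rewrite orient_rotate.
  apply He; [apply Hs; lia|apply Hs; lia|].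
  now apply HT.
Qed.

Lemma segments_cross (p q r w : point) :
  orient p q r * orient p q w < 0 -> orient r w p * orient r w q < 0 ->
  exists s t, 0 <= s < 1 /\ 0 <= t < 1 /\
    fst p + s * fst (vec p q) = fst r + t * fst (vec r w) /\
    snd p + s * snd (vec p q) = snd r + t * snd (vec r w).
Proof.
intros H1 H2.
assert (quot : forall a b, a * b < 0 -> a - b <> 0 /\ 0 <= a / (a - b) < 1).
{ intros a b H.
  assert (N : a - b <> 0) by nra.
  split; [exact N|].
  destruct (Rlt_dec 0 a) as [P|P].
  - assert (0 < a - b) by nra.
    split; [apply Rdiv_le_0_compat; lra|apply Rlt_div_l; nra].
  - assert (0 < b - a) by nra.
    replace (a / (a - b)) with (- a / (b - a)) by (field; lra).
    split; [apply Rdiv_le_0_compat; lra|apply Rlt_div_l; nra]. }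
(* An affine function with values [a] at 0 and [b] at 1 vanishes at [a / (a - b)]; each orientation
   is affine along the other segment. *)
destruct (quot _ _ H1) as [N1 Q1], (quot _ _ H2) as [N2 Q2].
exists (orient r w p / (orient r w p - orient r w q)),
  (orient p q r / (orient p q r - orient p q w)).
split; [exact Q2|split; [exact Q1|]].
revert N1 N2; unfold orient, cross, vec; cbn [fst snd]; intros N1 N2.
split; field; split; lra.
Qed.

Lemma period_nat (A : Type) (c : R -> A) (T : R) (n : nat) (t : R) :
  (forall t, c (t + T) = c t) -> c (t + INR n * T) = c t.
Proof.
intros H; induction n as [|n IH].
- f_equal; simpl; ring.
- rewrite <- IH, <- (H (t + INR n * T)), S_INR; f_equal; ring.
Qed.

Lemma period_Z (A : Type) (c : R -> A) (T : R) (k : Z) (t : R) :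
  (forall t, c (t + T) = c t) -> c (t + IZR k * T) = c t.
Proof.
intros H; destruct (Z_le_dec 0 k) as [K|K].
- rewrite <- (period_nat A c T (Z.to_nat k) t H).
  now rewrite INR_IZR_INZ, Z2Nat.id.
- rewrite <- (period_nat A c T (Z.to_nat (- k)) (t + IZR k * T) H).
  rewrite INR_IZR_INZ, Z2Nat.id by lia; rewrite opp_IZR; f_equal; ring.
Qed.

Lemma period_shift_in (T t0 t : R) : 0 < T -> exists k, t0 <= t + IZR k * T < t0 + T.
Proof.
intros HT.
destruct (euclidian_division (t - t0) T) as (k & r & E & Hr); [lra|].
rewrite Rabs_pos_eq in Hr by lra.
exists (- k)%Z; rewrite opp_IZR; lra.
Qed.

Lemma oval_inj (c : R -> point) (T s t : R) : oval c T ->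
  s < t -> t < s + T -> c s <> c t.
Proof.
intros (HT & _ & _ & _ & NZ) H1 H2 E.
apply (NZ s ((s + t) / 2) t); [lra..|].
rewrite E; unfold orient, cross, vec; cbn [fst snd]; ring.
Qed.

(** * Cyclic order of the vertices of a simple inscribed polygon *)

Section SimpleOrder.
Variables (c : R -> point) (T e : R).
Hypothesis O : oval c T.
Hypothesis He : forall r s t, r < s -> s < t -> t < r + T ->
  0 < e * orient (c r) (c s) (c t).
Variables (n : nat) (v : nat -> point) (t : nat -> R).
Hypothesis Hn : (3 <= n)%nat.
Hypothesis Sv : simple_polygon n v.
Hypothesis tv : forall i, (i < n)%nat -> c (t i) = v i.
Hypothesis t0 : forall i, (0 < i < n)%nat -> t 0%nat < t i < t 0%nat + T.

Lemma param_distinct i j : (i < n)%nat -> (j < n)%nat -> i <> j -> t i <> t j.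
Proof.
intros Hi Hj N E; apply N.
apply (Sv i j 0 0); try lia; try lra.
unfold edge_point; rewrite <- (tv i), <- (tv j), E by assumption.
f_equal; ring.
Qed.

Lemma param_range i j : (i < n)%nat -> (j < n)%nat -> t i < t j + T.
Proof.
intros Hi Hj; destruct O as [HT _].
destruct i as [|i], j as [|j].
- lra.
- destruct (t0 (S j)); [lia|]; lra.
- destruct (t0 (S i)); [lia|]; lra.
- destruct (t0 (S i)), (t0 (S j)); try lia; lra.
Qed.

(** All parameters lie in one period, so sorting three of them and permuting the triple decides its
    orientation. This reduces questions of position to linear arithmetic on the parameters. *)
Lemma orient_cyclic i j k : (i < n)%nat -> (j < n)%nat -> (k < n)%nat ->
  i <> j -> j <> k -> k <> i ->
  (0 < e * orient (v i) (v j) (v k) /\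
     (t i < t j < t k \/ t j < t k < t i \/ t k < t i < t j)) \/
  (e * orient (v i) (v j) (v k) < 0 /\
     (t i < t k < t j \/ t k < t j < t i \/ t j < t i < t k)).
Proof.
intros Hi Hj Hk N1 N2 N3.
rewrite <- (tv i), <- (tv j), <- (tv k) by assumption.
pose proof (param_distinct i j Hi Hj N1); pose proof (param_distinct j k Hj Hk N2);
  pose proof (param_distinct k i Hk Hi N3).
pose proof (param_range i j Hi Hj); pose proof (param_range j i Hj Hi);
pose proof (param_range i k Hi Hk); pose proof (param_range k i Hk Hi);
pose proof (param_range k j Hk Hj); pose proof (param_range j k Hj Hk).
assert (A : forall p q r, orient p q r = orient q r p /\ orient p q r = orient r p q /\
   orient p q r = - orient p r q /\ orient p q r = - orient r q p /\
   orient p q r = - orient q p r).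
{ intros; unfold orient, cross, vec; cbn [fst snd]; repeat split; ring. }
destruct (A (c (t i)) (c (t j)) (c (t k))) as (A1 & A2 & A3 & A4 & A5).
destruct (Rlt_dec (t i) (t j)), (Rlt_dec (t j) (t k)), (Rlt_dec (t k) (t i)); try lra.
- left; split; [apply He; lra|lra].
- left; split; [rewrite A2; apply He; lra|lra].
- right; split; [|lra]. rewrite A3; enough (0 < e * orient (c (t i)) (c (t k)) (c (t j))) by lra;
  apply He; lra.
- left; split; [rewrite A1; apply He; lra|lra].
- right; split; [|lra]. rewrite A5; enough (0 < e * orient (c (t j)) (c (t i)) (c (t k))) by lra;
  apply He; lra.
- right; split; [|lra]. rewrite A4; enough (0 < e * orient (c (t k)) (c (t j)) (c (t i))) by lra;
  apply He; lra.
Qed.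

(* Consecutive vertices on opposite sides of the line through an edge would make the
   two edges cross, because points of an oval are in convex position. *)
Lemma same_side i k : (i < n)%nat -> (k < n)%nat -> k <> i ->
  next n i <> k -> next n k <> i ->
  0 < orient (v i) (v (next n i)) (v k) * orient (v i) (v (next n i)) (v (next n k)).
Proof.
intros Hi Hk N1 N2 N3.
assert (Hi' : (next n i < n)%nat) by (destruct (next_cases n i Hi); lia).
assert (Hk' : (next n k < n)%nat) by (destruct (next_cases n k Hk); lia).
assert (Ni : next n i <> i) by (destruct (next_cases n i Hi); lia).
assert (Nk : next n k <> k) by (destruct (next_cases n k Hk); lia).
assert (N4 : next n k <> next n i).
{ destruct (next_cases n i Hi), (next_cases n k Hk); lia. }
apply Rnot_le_lt; intros H.
assert (C : ~ (orient (v i) (v (next n i)) (v k) * orient (v i) (v (next n i)) (v (next n k)) < 0 /\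
  orient (v k) (v (next n k)) (v i) * orient (v k) (v (next n k)) (v (next n i)) < 0)).
{ intros [C1 C2].
  destruct (segments_cross _ _ _ _ C1 C2) as (s & u & Hs & Hu & E1 & E2).
  destruct (Sv i k s u Hi Hk Hs Hu) as [E _]; [|lia].
  unfold edge_point; f_equal; assumption. }
assert (P1 := orient_cyclic i (next n i) k Hi Hi' Hk (not_eq_sym Ni) N2 N1).
assert (P2 := orient_cyclic i (next n i) (next n k) Hi Hi' Hk' (not_eq_sym Ni) (not_eq_sym N4) N3).
assert (P3 := orient_cyclic k (next n k) i Hk Hk' Hi (not_eq_sym Nk) N3 (not_eq_sym N1)).
assert (P4 := orient_cyclic k (next n k) (next n i) Hk Hk' Hi' (not_eq_sym Nk) N4 N2).
assert (E0 : e <> 0) by (intros ->; lra).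
set (a := orient (v i) (v (next n i)) (v k)) in *.
set (b := orient (v i) (v (next n i)) (v (next n k))) in *.
set (a' := orient (v k) (v (next n k)) (v i)) in *.
set (b' := orient (v k) (v (next n k)) (v (next n i))) in *.
assert (mulneg : forall x y, (0 < e * x /\ e * y < 0) \/ (e * x < 0 /\ 0 < e * y) -> x * y < 0).
{ intros x y [[X Y]|[X Y]].
  - assert (0 < (e * x) * - (e * y)) by (apply Rmult_lt_0_compat; lra).
    assert (0 < e * e) by nra. nra.
  - assert (0 < - (e * x) * (e * y)) by (apply Rmult_lt_0_compat; lra).
    assert (0 < e * e) by nra. nra. }
assert (mulpos : forall x y, (0 < e * x /\ 0 < e * y) \/ (e * x < 0 /\ e * y < 0) -> 0 < x * y).
{ intros x y [[X Y]|[X Y]].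
  - assert (0 < (e * x) * (e * y)) by (apply Rmult_lt_0_compat; lra).
    assert (0 < e * e) by nra. nra.
  - assert (0 < - (e * x) * - (e * y)) by (apply Rmult_lt_0_compat; lra).
    assert (0 < e * e) by nra. nra. }
(* If edge [i] separates the ends of edge [k], equal signs of [a'] and [b'] contradict the cyclic
   order of the four parameters, and opposite signs make the edges cross. *)
destruct P1 as [[S1 P1]|[S1 P1]], P2 as [[S2 P2]|[S2 P2]].
- pose proof (mulpos a b (or_introl (conj S1 S2))); lra.
- destruct P3 as [[S3 P3]|[S3 P3]], P4 as [[S4 P4]|[S4 P4]].
  + exfalso; clear - P1 P2 P3 P4; destruct P1 as [P1|[P1|P1]], P2 as [P2|[P2|P2]], P3 as [P3|[P3|P3]]; lra.
  + apply C; split; apply mulneg; [left|left]; split; assumption.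
  + apply C; split; apply mulneg; [left|right]; split; assumption.
  + exfalso; clear - P1 P2 P3 P4; destruct P1 as [P1|[P1|P1]], P2 as [P2|[P2|P2]], P3 as [P3|[P3|P3]]; lra.
- destruct P3 as [[S3 P3]|[S3 P3]], P4 as [[S4 P4]|[S4 P4]].
  + exfalso; clear - P1 P2 P3 P4; destruct P1 as [P1|[P1|P1]], P2 as [P2|[P2|P2]], P3 as [P3|[P3|P3]]; lra.
  + apply C; split; apply mulneg; [right|left]; split; assumption.
  + apply C; split; apply mulneg; [right|right]; split; assumption.
  + exfalso; clear - P1 P2 P3 P4; destruct P1 as [P1|[P1|P1]], P2 as [P2|[P2|P2]], P3 as [P3|[P3|P3]]; lra.
- pose proof (mulpos a b (or_intror (conj S1 S2))); lra.
Qed.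

(** A positive product encodes that two orientations have the same strict sign; this composes such
    comparisons along the polygon. *)
Lemma Rmult_pos_trans (x y z : R) : 0 < x * y -> 0 < y * z -> 0 < x * z.
Proof.
intros H1 H2.
assert (0 < (x * y) * (y * z)) by (now apply Rmult_lt_0_compat).
assert (0 <= y * y) by nra.
apply Rnot_le_lt; intros K; nra.
Qed.

Lemma Rmult_pos_self (x y : R) : 0 < x * y -> 0 < y * y.
Proof. intros H; nra. Qed.

(** Walking from [v 0] up to the edge [i], no step changes side, by [same_side]. For [i = 1] there
    is no such step, and the sign is nonzero by [orient_cyclic]. *)
Lemma side_low i : (1 <= i)%nat -> (S i < n)%nat -> forall j, (S j <= i)%nat ->
  0 < orient (v i) (v (S i)) (v 0%nat) * orient (v i) (v (S i)) (v j).
Proof.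
intros H1 H2; induction j as [|j IH]; intros Hj.
- pose proof (same_side i 0) as P.
  rewrite (next_lt n i H2), (next_lt n 0) in P by lia.
  destruct (Nat.eq_dec i 1) as [->|N].
  + destruct (orient_cyclic 1 2 0) as [[? _]|[? _]]; try lia; nra.
  + assert (Q : 0 < orient (v i) (v (S i)) (v 0%nat) * orient (v i) (v (S i)) (v 1%nat))
      by (apply P; lia).
    apply Rmult_pos_self with (orient (v i) (v (S i)) (v 1%nat)); lra.
- apply Rmult_pos_trans with (orient (v i) (v (S i)) (v j)); [apply IH; lia|].
  pose proof (same_side i j) as P.
  rewrite (next_lt n i H2), (next_lt n j) in P by lia.
  apply P; lia.
Qed.

(** Here the walk goes forward from [v j] to [v 0] through the closing edge; [m] counts the steps
    before that edge. *)
Lemma side_high i : (1 <= i)%nat -> (S i < n)%nat -> forall m j, (j + m = n - 1)%nat -> (i + 2 <= j)%nat ->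
  0 < orient (v i) (v (S i)) (v j) * orient (v i) (v (S i)) (v 0%nat).
Proof.
intros H1 H2; induction m as [|m IH]; intros j Hm Hj.
- pose proof (same_side i j) as P.
  rewrite (next_lt n i H2), (next_last n j) in P by lia.
  apply P; lia.
- apply Rmult_pos_trans with (orient (v i) (v (S i)) (v (S j))); [|apply IH; lia].
  pose proof (same_side i j) as P.
  rewrite (next_lt n i H2), (next_lt n j) in P by lia.
  apply P; lia.
Qed.

(** The triple [v i], [v (S i)], [v (S (S i))] belongs to two edges: it compares with [v 0] across
    the first by [side_high] and, once rotated, across the second by [side_low]. *)
Lemma side_step i : (1 <= i)%nat -> (S (S i) < n)%nat ->
  0 < orient (v i) (v (S i)) (v 0%nat) * orient (v (S i)) (v (S (S i))) (v 0%nat).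
Proof.
intros H1 H2.
apply Rmult_pos_trans with (orient (v i) (v (S i)) (v (S (S i)))).
- rewrite Rmult_comm; apply (side_high i H1) with (n - 1 - S (S i))%nat; lia.
- rewrite orient_rotate, Rmult_comm; apply side_low; lia.
Qed.

Lemma side_const i : (1 <= i)%nat -> (S i < n)%nat ->
  0 < orient (v 1%nat) (v 2%nat) (v 0%nat) * orient (v i) (v (S i)) (v 0%nat).
Proof.
induction i as [|i IH]; intros H1 H2; [lia|].
destruct i as [|i].
- apply Rmult_pos_self with (orient (v 1%nat) (v 2%nat) (v 0%nat)).
  destruct (orient_cyclic 1 2 0) as [[? _]|[? _]]; try lia; nra.
- apply Rmult_pos_trans with (orient (v (S i)) (v (S (S i))) (v 0%nat)).
  + apply IH; lia.
  + apply side_step; lia.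
Qed.

(** Since [t 0] is the smallest parameter, the orientation of [v i], [v (S i)], [v 0] tells which of
    [t i] and [t (S i)] is larger, and by [side_const] its sign is the same for all [i]. *)
Lemma simple_polygon_sorted :
  (forall i, (1 <= i)%nat -> (S i < n)%nat -> t i < t (S i)) \/
  (forall i, (1 <= i)%nat -> (S i < n)%nat -> t (S i) < t i).
Proof.
assert (E0 : forall x y, 0 < x * y -> 0 < e * x -> 0 < e * y).
{ intros x y H1 H2; apply Rmult_pos_trans with x; lra. }
assert (L0 : forall i, (0 < i < n)%nat -> t 0%nat < t i) by (intros i Hi; now apply t0).
destruct (orient_cyclic 1 2 0) as [[S1 _]|[S1 _]]; try lia.
- left; intros i H1 H2.
  pose proof (E0 _ _ (side_const i H1 H2) S1) as P.
  pose proof (L0 i ltac:(lia)); pose proof (L0 (S i) ltac:(lia)).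
  destruct (orient_cyclic i (S i) 0) as [[? Q]|[? _]]; try lia; lra.
- right; intros i H1 H2.
  assert (P : 0 < e * - orient (v i) (v (S i)) (v 0%nat)).
  { apply E0 with (- orient (v 1%nat) (v 2%nat) (v 0%nat)); [|lra].
    pose proof (side_const i H1 H2); lra. }
  pose proof (L0 i ltac:(lia)); pose proof (L0 (S i) ltac:(lia)).
  destruct (orient_cyclic i (S i) 0) as [[? _]|[? Q]]; try lia; lra.
Qed.
End SimpleOrder.

(* Coquelicot states equations between values of [RInt] and [sum_n] in a carrier that
   is only convertible to [R], where [ring] and [field] fail. *)
Ltac eqR := match goal with |- @eq _ ?a ?b => change (@eq R a b) end.

(** * Bounds for the areas of inscribed polygons *)

Lemma sum_n_RS (a : nat -> R) (m : nat) : sum_n a (S m) = sum_n a m + a (S m).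
Proof. rewrite sum_Sn; reflexivity. Qed.

(* The triangulation of the polygon from its vertex [v 0]. *)
Lemma sum_cross_fan (n : nat) (v : nat -> point) (m : nat) : (S m < n)%nat ->
  sum_n (fun i => cross (v i) (v (next n i))) m =
  sum_n (fun i => orient (v 0%nat) (v i) (v (S i))) m + cross (v 0%nat) (v (S m)).
Proof.
induction m as [|m IH]; intros Hm; eqR.
- rewrite !sum_O, next_lt by lia.
  unfold orient, cross, vec; cbn [fst snd]; ring.
- rewrite !sum_n_RS, IH, (next_lt n (S m)) by lia.
  unfold orient, cross, vec; cbn [fst snd]; ring.
Qed.

Lemma sum_cross_closed (n : nat) (v : nat -> point) : (3 <= n)%nat ->
  sum_n (fun i => cross (v i) (v (next n i))) (pred n) =
  sum_n (fun i => orient (v 0%nat) (v i) (v (S i))) (n - 2).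
Proof.
intros Hn; eqR; replace (pred n) with (S (n - 2)) by lia.
rewrite sum_n_RS, sum_cross_fan by lia.
rewrite (next_last n (S (n - 2))) by lia.
replace (S (n - 2)) with (n - 1)%nat by lia.
unfold cross; ring.
Qed.

Lemma sum_n_nonneg (a : nat -> R) (m : nat) :
  (forall i, (i <= m)%nat -> 0 <= a i) -> 0 <= sum_n a m.
Proof.
induction m as [|m IH]; intros H.
- rewrite sum_O; apply H; lia.
- rewrite sum_n_RS; apply Rplus_le_le_0_compat; [apply IH; intros; apply H; lia|apply H; lia].
Qed.

(** Bounding each edge by the increment of a potential [G] plus a constant [k] telescopes around the
    polygon, [M] being the increment of [G] over a period. It serves with the sector area and
    [k = 0], and for ellipses with a tangent line of the sine. *)
Lemma simple_polygon_area_le (c : R -> point) (T M k : R) (G : R -> R)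
    (n : nat) (v : nat -> point) :
  oval c T ->
  (forall r s t, r < s -> s < t -> t < r + T -> 0 < orient (c r) (c s) (c t)) ->
  (forall t, G (t + T) = G t + M) ->
  (forall s t, s < t -> t < s + T -> cross (c s) (c t) <= G t - G s + k) ->
  (3 <= n)%nat -> simple_polygon n v -> (forall i, (i < n)%nat -> exists t, c t = v i) ->
  polygon_area n v <= (M + INR n * k) / 2.
Proof.
intros O He HG Hk Hn Sv Iv.
pose proof O as (HT & _ & _ & per & _).
(* All parameters are chosen in the period that starts at the one of [v 0]. *)
destruct (Iv 0%nat) as [t0 E0]; [lia|].
assert (ch : forall i, exists t, (i < n)%nat -> c t = v i /\ t0 <= t < t0 + T).
{ intros i; destruct (le_lt_dec n i) as [L|L]; [exists 0; lia|].
  destruct (Iv i L) as [t Et].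
  destruct (period_shift_in T t0 t HT) as [k0 Ht].
  exists (t + IZR k0 * T); intros _; split; [now rewrite period_Z|exact Ht]. }
set (t := fun i => proj1_sig (constructive_indefinite_description _ (ch i))).
assert (Ht : forall i, (i < n)%nat -> c (t i) = v i /\ t0 <= t i < t0 + T).
{ intros i; exact (proj2_sig (constructive_indefinite_description _ (ch i))). }
clearbody t; clear ch.
assert (tv : forall i, (i < n)%nat -> c (t i) = v i) by (intros i Hi; now apply Ht).
assert (T0 : t 0%nat = t0).
{ destruct (Ht 0%nat) as [E R0]; [lia|].
  destruct (Req_dec t0 (t 0%nat)) as [E1|N]; [now symmetry|exfalso].
  apply (oval_inj c T t0 (t 0%nat) O); try lra.
  now rewrite E. }
assert (Ht0 : forall i, (0 < i < n)%nat -> t 0%nat < t i < t 0%nat + T).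
{ intros i Hi; destruct (Ht i) as [E R0]; [lia|].
  split; [|lra].
  destruct (Rle_lt_or_eq_dec t0 (t i)) as [L|L]; [lra|lra|exfalso].
  assert (E' : v i = v 0%nat) by (rewrite <- E, <- E0, L; reflexivity).
  destruct (Sv i 0%nat 0 0) as [A _]; try lia; try lra.
  unfold edge_point; rewrite E'; f_equal; ring. }
assert (He' : forall r s t, r < s -> s < t -> t < r + T -> 0 < 1 * orient (c r) (c s) (c t)).
{ intros; rewrite Rmult_1_l; now apply He. }
assert (S0 : INR n = INR (n - 2) + 2).
{ replace n with (S (S (n - 2))) at 1 by lia; rewrite !S_INR; ring. }
assert (lo : t 0%nat < t 1%nat) by (apply Ht0; lia).
unfold polygon_area; apply Rmult_le_compat_r; [lra|].
destruct (simple_polygon_sorted c T 1 O He' n v t Hn Sv tv Ht0) as [inc|dec].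
- assert (inc' : forall j i, (i <= j)%nat -> (j < n)%nat -> t i <= t j).
  { induction j as [|j IH]; intros i Hi Hj; [replace i with 0%nat by lia; lra|].
    destruct (Nat.eq_dec i (S j)) as [->|N]; [lra|].
    specialize (IH i); destruct (Nat.eq_dec j 0) as [->|Nj].
    - replace i with 0%nat by lia; lra.
    - specialize (inc j); apply Rle_trans with (t j); [apply IH; lia|apply Rlt_le, inc; lia]. }
  assert (incS : forall i, (S i < n)%nat -> t i < t (S i)).
  { intros [|i] Hi; [exact lo|apply inc; lia]. }
  rewrite Rabs_pos_eq.
  + replace (pred n) with (S (n - 2)) by lia; rewrite sum_n_RS.
    assert (B : forall m, (S m < n)%nat ->
       sum_n (fun i => cross (v i) (v (next n i))) m <= G (t (S m)) - G t0 + (INR m + 1) * k).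
    { induction m as [|m IH]; intros Hm.
      - rewrite sum_O, next_lt, <- !tv by lia. rewrite <- T0 at 1.
        pose proof (Hk (t 0%nat) (t 1%nat) lo). rewrite T0 in *. simpl INR.
        destruct (Ht0 1%nat); [lia|]; lra.
      - rewrite sum_n_RS, (next_lt n (S m)) by lia.
        rewrite <- (tv (S m)), <- (tv (S (S m))) by lia.
        pose proof (incS (S m) Hm) as I.
        destruct (Ht0 (S m)) as [I1 I2], (Ht0 (S (S m))) as [I3 I4]; try lia.
        specialize (IH ltac:(lia)).
        specialize (Hk _ _ I ltac:(lra)); rewrite (S_INR m); lra. }
    (* The closing edge ends at [v 0], taken at the parameter [t0 + T]. *)
    specialize (B (n - 2)%nat ltac:(lia)).
    rewrite (next_last n (S (n - 2))) by lia.
    rewrite <- (tv (S (n - 2))), <- E0, <- (per t0) by lia.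
    destruct (Ht0 (S (n - 2))) as [I1 I2]; [lia|].
    specialize (Hk (t (S (n - 2))) (t0 + T) ltac:(lra) ltac:(lra)).
    rewrite HG in Hk; rewrite S0; lra.
  (* The triangles of the fan from [v 0] are positively oriented, which removes the absolute
     value. *)
  + rewrite sum_cross_closed by exact Hn.
    apply sum_n_nonneg; intros i Hi; rewrite <- !tv by lia.
    destruct i as [|i].
    { apply Req_le; unfold orient, cross, vec; cbn [fst snd]; ring. }
    apply Rlt_le, He; [apply Ht0; lia|apply incS; lia|apply Ht0; lia].
(* The polygon runs backwards: the opposite of the shoelace sum telescopes, and the first edge is
   now the one that wraps around the period. *)
- rewrite Rabs_left1.
  + replace (pred n) with (S (n - 2)) by lia; rewrite sum_n_RS.
    assert (B : forall m, (S m < n)%nat ->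
       - sum_n (fun i => cross (v i) (v (next n i))) m <= G (t0 + T) - G (t (S m)) + (INR m + 1) * k).
    { induction m as [|m IH]; intros Hm.
      - rewrite sum_O, next_lt by lia. rewrite <- (tv 1%nat), <- E0, <- per by lia.
        destruct (Ht0 1%nat) as [I1 I2]; [lia|].
        specialize (Hk (t 1%nat) (t0 + T) ltac:(lra) ltac:(lra)).
        simpl INR; revert Hk; unfold cross; lra.
      - rewrite sum_n_RS, (next_lt n (S m)) by lia.
        rewrite <- (tv (S m)), <- (tv (S (S m))) by lia.
        pose proof (dec (S m) ltac:(lia) Hm) as I.
        destruct (Ht0 (S m)) as [I1 I2], (Ht0 (S (S m))) as [I3 I4]; try lia.
        specialize (IH ltac:(lia)).
        specialize (Hk _ _ I ltac:(lra)); rewrite (S_INR m); revert Hk IH; unfold cross; lra. }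
    specialize (B (n - 2)%nat ltac:(lia)).
    rewrite (next_last n (S (n - 2))) by lia.
    rewrite <- (tv (S (n - 2))), <- E0 by lia.
    destruct (Ht0 (S (n - 2))) as [I1 I2]; [lia|].
    specialize (Hk t0 (t (S (n - 2))) ltac:(lra) ltac:(lra)).
    rewrite HG in B; rewrite S0; revert Hk B; unfold cross; lra.
  + rewrite sum_cross_closed by exact Hn.
    enough (0 <= sum_n (fun i => - orient (v 0%nat) (v i) (v (S i))) (n - 2)) as P.
    { revert P; generalize (n - 2)%nat as m.
      intros m; replace (sum_n (fun i => - orient (v 0%nat) (v i) (v (S i))) m)
        with (- sum_n (fun i => orient (v 0%nat) (v i) (v (S i))) m); [lra|].
      induction m as [|m IH]; [now rewrite !sum_O|rewrite !sum_n_RS, <- IH; ring]. }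
    apply sum_n_nonneg; intros i Hi.
    destruct i as [|i].
    { apply Req_le; unfold orient, cross, vec; cbn [fst snd]; ring. }
    rewrite <- !tv by lia.
    pose proof (dec (S i) ltac:(lia) ltac:(lia)).
    replace (- orient (c (t 0%nat)) (c (t (S i))) (c (t (S (S i)))))
      with (orient (c (t 0%nat)) (c (t (S (S i)))) (c (t (S i))))
      by (unfold orient, cross, vec; cbn [fst snd]; ring).
    apply Rlt_le, He; [apply Ht0; lia|assumption|apply Ht0; lia].
Qed.

(** The competitor has [n] equally spaced parameters starting at [u]; by periodicity the closing
    edge has the same form as the others. *)
Lemma max_area_ge_sum (g : point -> Prop) (n : nat) (A : R) (c : R -> point) (T u : R) :
  (3 <= n)%nat -> is_max_inscribed_area g n A -> oval c T -> (forall t, g (c t)) ->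
  sum_n (fun i => cross (c (u + INR i * (T / INR n))) (c (u + INR i * (T / INR n) + T / INR n))) (pred n)
    <= 2 * A.
Proof.
intros Hn [_ HA] O Hg.
pose proof O as (HT & _ & _ & per & _).
assert (n0 : 0 < INR n) by (apply lt_0_INR; lia).
assert (h0 : 0 < T / INR n) by (apply Rdiv_lt_0_compat; lra).
assert (nh : INR n * (T / INR n) = T) by (field; lra).
set (h := T / INR n) in *.
set (s := fun i => u + INR i * h).
assert (H : polygon_area n (fun i => c (s i)) <= A).
{ apply HA.
  - apply oval_polygon_simple with T; [exact O|exact Hn| |].
    + intros i j Hij _; unfold s; apply lt_INR in Hij; nra.
    + intros i Hi; unfold s; apply lt_INR in Hi; simpl INR; nra.
  - intros i _; apply Hg. }
unfold polygon_area in H.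
rewrite (sum_n_ext_loc _ (fun i => cross (c (s i)) (c (s (next n i))))).
- pose proof (Rle_abs (sum_n (fun i => cross (c (s i)) (c (s (next n i)))) (pred n))); lra.
- intros i Hi; f_equal.
  destruct (next_cases n i) as [[_ E]|[L E]]; [lia| |]; rewrite E; unfold s.
  + f_equal; rewrite S_INR; ring.
  + replace (u + INR i * h + h) with (u + INR 0 * h + T); [apply per|].
    rewrite <- nh, <- L, S_INR; simpl INR; ring.
Qed.

(** * Averages over inscribed polygons *)

Lemma ex_RInt_cont (f : R -> R) (a b : R) :
  (forall t, continuous f t) -> ex_RInt f a b.
Proof. intros H; apply (ex_RInt_continuous (V := R_CompleteNormedModule)); intros; apply H. Qed.

Lemma RInt_add (f g : R -> R) (a b : R) :
  (forall t, continuous f t) -> (forall t, continuous g t) ->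
  RInt (fun t => f t + g t) a b = RInt f a b + RInt g a b.
Proof. intros Hf Hg; apply (RInt_plus f g); now apply ex_RInt_cont. Qed.

Lemma RInt_sub (f g : R -> R) (a b : R) :
  (forall t, continuous f t) -> (forall t, continuous g t) ->
  RInt (fun t => f t - g t) a b = RInt f a b - RInt g a b.
Proof. intros Hf Hg; apply (RInt_minus f g); now apply ex_RInt_cont. Qed.

Lemma RInt_mul (k : R) (f : R -> R) (a b : R) :
  (forall t, continuous f t) -> RInt (fun t => k * f t) a b = k * RInt f a b.
Proof. intros Hf; apply (RInt_scal f); now apply ex_RInt_cont. Qed.

Lemma RInt_le_cont (f g : R -> R) (a b : R) : a <= b ->
  (forall t, continuous f t) -> (forall t, continuous g t) ->
  (forall t, f t <= g t) -> RInt f a b <= RInt g a b.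
Proof. intros L Hf Hg H; apply RInt_le; try (now apply ex_RInt_cont); auto. Qed.

Lemma RInt_cst (k a b : R) : RInt (fun _ => k) a b = (b - a) * k.
Proof. apply (RInt_const (V := R_CompleteNormedModule)). Qed.

Lemma RInt_split (f : R -> R) (a b d : R) :
  (forall t, continuous f t) -> RInt f a b + RInt f b d = RInt f a d.
Proof. intros Hf; apply (RInt_Chasles f); now apply ex_RInt_cont. Qed.

Lemma RInt_shift (f : R -> R) (a b d : R) :
  (forall t, continuous f t) -> RInt (fun t => f (t + d)) a b = RInt f (a + d) (b + d).
Proof.
intros Hf.
pose proof (RInt_comp_lin f 1 d a b) as H.
rewrite !Rmult_1_l in H; rewrite <- H by now apply ex_RInt_cont.
apply RInt_ext; intros t _.
change (f (t + d) = 1 * f (1 * t + d)); rewrite !Rmult_1_l; reflexivity.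
Qed.

Lemma RInt_periodic (f : R -> R) (U d : R) :
  (forall t, continuous f t) -> (forall t, f (t + U) = f t) ->
  RInt (fun t => f (t + d)) 0 U = RInt f 0 U.
Proof.
intros Hf Hp; rewrite RInt_shift by exact Hf; rewrite Rplus_0_l.
rewrite <- (RInt_split f d 0 (U + d) Hf), <- (RInt_split f 0 U (U + d) Hf).
assert (E : RInt f U (U + d) = RInt f 0 d).
{ pose proof (RInt_shift f 0 d U Hf) as E.
  rewrite Rplus_0_l, (Rplus_comm d) in E; rewrite <- E.
  apply RInt_ext; intros; apply Hp. }
rewrite E.
pose proof (RInt_split f 0 d 0 Hf) as E2.
rewrite (RInt_point (V := R_CompleteNormedModule)) in E2.
change (RInt f 0 d + RInt f d 0 = 0) in E2; lra.
Qed.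

Lemma continuous_sum_n (F : nat -> R -> R) (m : nat) (x : R) :
  (forall i t, continuous (F i) t) -> continuous (fun t => sum_n (fun i => F i t) m) x.
Proof.
intros H; induction m as [|m IH].
- apply (continuous_ext (F 0%nat)); [intros t; now rewrite sum_O|apply H].
- apply (continuous_ext (fun t => sum_n (fun i => F i t) m + F (S m) t)).
  + intros t; now rewrite sum_n_RS.
  + apply continuous_Rplus; [exact IH|apply H].
Qed.

Lemma RInt_sum_n_same (F : nat -> R -> R) (m : nat) (a b v : R) :
  (forall i t, continuous (F i) t) -> (forall i, RInt (F i) a b = v) ->
  RInt (fun t => sum_n (fun i => F i t) m) a b = INR (S m) * v.
Proof.
intros H Hv; induction m as [|m IH].
- rewrite Rmult_1_l, <- (Hv 0%nat).
  apply RInt_ext; intros; now rewrite sum_O.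
- rewrite (RInt_ext _ (fun t => sum_n (fun i => F i t) m + F (S m) t)).
  + rewrite RInt_add, IH, Hv, (S_INR (S m)); [eqR; ring| |apply H].
    intros; now apply continuous_sum_n.
  + intros; now rewrite sum_n_RS.
Qed.

(** By periodicity all [n] edges have the same integral over [u], that of [D]. In the product
    containing the ordinate at [u + h], a shift by [h] brings the ordinate back to [u]. *)
Lemma average_area_le (g : point -> Prop) (n : nat) (A : R) (c : R -> point) (T : R) :
  (3 <= n)%nat -> is_max_inscribed_area g n A -> oval c T -> (forall t, g (c t)) ->
  INR n * RInt (fun u => snd (c u) * (fst (c (u - T / INR n)) - fst (c (u + T / INR n)))) 0 T
    <= 2 * A * T.
Proof.
intros Hn HA O Hg.
pose proof O as (HT & Cx & Cy & per & _).
set (h := T / INR n).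
set (D := fun u => cross (c u) (c (u + h))).
assert (CD : forall t, continuous D t).
{ intros t; unfold D, cross; cont. }
assert (PD : forall t, D (t + T) = D t).
{ intros t; unfold D; rewrite per; f_equal.
  replace (t + T + h) with (t + h + T) by ring; apply per. }
assert (I1 : RInt (fun u => sum_n (fun i => D (u + INR i * h)) (pred n)) 0 T
  = INR (S (pred n)) * RInt D 0 T).
{ apply (RInt_sum_n_same (fun i u => D (u + INR i * h))).
  - intros i t; cont.
  - intros i; now apply RInt_periodic. }
replace (S (pred n)) with n in I1 by lia.
assert (I2 : RInt (fun u => sum_n (fun i => D (u + INR i * h)) (pred n)) 0 T <= 2 * A * T).
{ replace (2 * A * T) with (RInt (fun _ => 2 * A) 0 T) by (rewrite RInt_cst; eqR; ring).
  apply RInt_le_cont; [lra| |intros; cont|].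
  - intros t; apply (continuous_sum_n (fun i u => D (u + INR i * h))).
    intros i s; cont.
  - intros u; now apply max_area_ge_sum with (g := g). }
enough (E : RInt D 0 T = RInt (fun u => snd (c u) * (fst (c (u - h)) - fst (c (u + h)))) 0 T)
  by (rewrite <- E; lra).
unfold D, cross.
rewrite RInt_sub; [|intros; cont..].
rewrite (RInt_ext (fun u => snd (c u) * (fst (c (u - h)) - fst (c (u + h))))
  (fun u => fst (c (u - h)) * snd (c u) - snd (c u) * fst (c (u + h))))
  by (intros; eqR; ring).
rewrite RInt_sub; [|intros; cont..].
f_equal.
rewrite <- (RInt_periodic (fun u => fst (c (u - h)) * snd (c u)) T h).
- apply RInt_ext; intros u _; now replace (u + h - h) with u by ring.
- intros; cont.
- intros t; rewrite per; f_equal.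
  replace (t + T - h) with (t - h + T) by ring; now rewrite per.
Qed.

(** By the mean value theorem; the factor [1 / (k + 1)] of an integration is given up, as only the
    order in [t] matters. *)
Lemma bound_of_derive_bound (F F' : R -> R) (M : R) (k : nat) : 0 <= M ->
  (forall t, is_derive F t (F' t)) -> F 0 = 0 ->
  (forall t, 0 <= t -> Rabs (F' t) <= M * t ^ k) ->
  forall t, 0 <= t -> Rabs (F t) <= M * t ^ S k.
Proof.
intros M0 HF F0 HB t Ht.
destruct (MVT_gen F 0 t F') as (z & Hz & E).
- intros; apply HF.
- intros; apply continuity_pt_filterlim, (ex_derive_continuous F); eexists; apply HF.
- rewrite Rmin_left, Rmax_right in Hz by lra.
  rewrite F0, !Rminus_0_r in E; rewrite E, Rabs_mult, (Rabs_pos_eq t) by lra.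
  simpl pow; rewrite (Rmult_comm t), <- Rmult_assoc.
  apply Rmult_le_compat_r; [lra|].
  apply Rle_trans with (M * z ^ k); [apply HB; lra|].
  apply Rmult_le_compat_l; [lra|apply pow_incr; lra].
Qed.

(** The error and its first three derivatives in [h] vanish at 0, and the fourth is a difference of
    two values of [X4], hence at most [2 * M]. Four integrations give the bound. *)
Lemma central_taylor (X X1 X2 X3 X4 : R -> R) (M u : R) : 0 <= M ->
  (forall t, is_derive X t (X1 t)) -> (forall t, is_derive X1 t (X2 t)) ->
  (forall t, is_derive X2 t (X3 t)) -> (forall t, is_derive X3 t (X4 t)) ->
  (forall t, Rabs (X4 t) <= M) ->
  forall h, 0 <= h ->
  Rabs (X (u - h) - X (u + h) + 2 * h * X1 u + h ^ 3 / 3 * X3 u) <= 2 * M * h ^ 4.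
Proof.
intros M0 H1 H2 H3 H4 HM.
assert (dp : forall f f' : R -> R, (forall t, is_derive f t (f' t)) ->
  forall h, is_derive (fun h => f (u + h)) h (f' (u + h))).
{ intros f f' Hf h; evar_last; [deriv|ring]. }
assert (dm : forall f f' : R -> R, (forall t, is_derive f t (f' t)) ->
  forall h, is_derive (fun h => f (u - h)) h (- f' (u - h))).
{ intros f f' Hf h; evar_last; [deriv|ring]. }
(* Successive derivatives alternate between differences, [s = 1], and sums, [s = -1], of the values
   at [u - h] and [u + h]. *)
assert (dd : forall (s : R) (f f' p p' : R -> R), (forall t, is_derive f t (f' t)) ->
  (forall t, is_derive p t (p' t)) ->
  forall h, is_derive (fun h => f (u - h) - s * f (u + h) + p h) h
    (- f' (u - h) - s * f' (u + h) + p' h)).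
{ intros s f f' p p' Hf Hp h.
  apply (is_derive_plus (fun h => f (u - h) - s * f (u + h)) p); [|apply Hp].
  apply (is_derive_minus (fun h => f (u - h)) (fun h => s * f (u + h))); [now apply dm|].
  apply (is_derive_scal (fun h => f (u + h))); now apply dp. }
apply (bound_of_derive_bound _
  (fun h => - (X1 (u - h) + X1 (u + h)) + 2 * X1 u + h ^ 2 * X3 u)); [lra| | |].
{ intros h; evar_last.
  - apply (is_derive_ext (fun h => X (u - h) - 1 * X (u + h) + (2 * h * X1 u + h ^ 3 / 3 * X3 u)));
      [intros; eqR; ring|].
    apply (dd 1 X X1 _ (fun h => 2 * X1 u + h ^ 2 * X3 u)); [exact H1|].
    intros t; auto_derive; [exact I|field].
  - eqR; ring. }
{ cbv beta; rewrite Rminus_0_r, Rplus_0_r; field. }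
apply (bound_of_derive_bound _
  (fun h => X2 (u - h) - X2 (u + h) + 2 * h * X3 u)); [lra| | |].
{ intros h; evar_last.
  - apply (is_derive_ext (fun h => - (X1 (u - h) - (-1) * X1 (u + h) + - (2 * X1 u + h ^ 2 * X3 u))));
      [intros; eqR; ring|].
    apply (is_derive_opp (fun h => X1 (u - h) - (-1) * X1 (u + h) + - (2 * X1 u + h ^ 2 * X3 u))).
    apply (dd (-1) X1 X2 _ (fun h => - (2 * h * X3 u))); [exact H2|].
    intros t; auto_derive; [exact I|field].
  - unfold opp; simpl; ring. }
{ cbv beta; rewrite Rminus_0_r, Rplus_0_r; field. }
apply (bound_of_derive_bound _
  (fun h => - (X3 (u - h) + X3 (u + h)) + 2 * X3 u)); [lra| | |].
{ intros h; evar_last.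
  - apply (is_derive_ext (fun h => X2 (u - h) - 1 * X2 (u + h) + (2 * h * X3 u)));
      [intros; eqR; ring|].
    apply (dd 1 X2 X3 _ (fun h => 2 * X3 u)); [exact H3|].
    intros t; auto_derive; [exact I|ring].
  - eqR; ring. }
{ cbv beta; rewrite Rminus_0_r, Rplus_0_r; field. }
apply (bound_of_derive_bound _
  (fun h => X4 (u - h) - X4 (u + h))); [lra| | |].
{ intros h; evar_last.
  - apply (is_derive_ext (fun h => - (X3 (u - h) - (-1) * X3 (u + h) + - (2 * X3 u))));
      [intros; eqR; ring|].
    apply (is_derive_opp (fun h => X3 (u - h) - (-1) * X3 (u + h) + - (2 * X3 u))).
    apply (dd (-1) X3 X4 _ (fun h => 0)); [exact H4|].
    intros t; auto_derive; [exact I|ring].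
  - unfold opp; simpl; ring. }
{ cbv beta; rewrite Rminus_0_r, Rplus_0_r; field. }
intros h _; rewrite pow_O, Rmult_1_r.
pose proof (HM (u - h)) as B1; pose proof (HM (u + h)) as B2.
apply Rabs_le_between in B1; apply Rabs_le_between in B2; apply Rabs_le_between; lra.
Qed.

Lemma continuous_of_derive (f f' : R -> R) :
  (forall t, is_derive f t (f' t)) -> forall t, continuous f t.
Proof. intros H t; apply (ex_derive_continuous f); eexists; apply H. Qed.

(* The shift in [average_area_le] has moved all increments onto the abscissa, so the
   ordinate need not be differentiable. *)
Lemma max_area_lower_expansion (g : point -> Prop) (c : R -> point) (T M N : R)
    (X1 X2 X3 X4 : R -> R) :
  oval c T -> (forall t, g (c t)) ->
  (forall t, is_derive (fun s => fst (c s)) t (X1 t)) -> (forall t, is_derive X1 t (X2 t)) ->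
  (forall t, is_derive X2 t (X3 t)) -> (forall t, is_derive X3 t (X4 t)) ->
  (forall t, Rabs (X4 t) <= M) -> (forall t, Rabs (snd (c t)) <= N) ->
  exists C, forall n A, (3 <= n)%nat -> is_max_inscribed_area g n A ->
    - RInt (fun u => snd (c u) * X1 u) 0 T
      - T ^ 2 / 6 * RInt (fun u => snd (c u) * X3 u) 0 T / INR n ^ 2 - C / INR n ^ 3 <= A.
Proof.
intros O Hg H1 H2 H3 H4 HM HN.
pose proof O as (HT & Cx & Cy & per & _).
assert (M0 : 0 <= M) by (eapply Rle_trans; [apply Rabs_pos|apply (HM 0)]).
assert (N0 : 0 <= N) by (eapply Rle_trans; [apply Rabs_pos|apply (HN 0)]).
pose proof (continuous_of_derive _ _ H2) as C1.
pose proof (continuous_of_derive _ _ H4) as C3.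
(* The remainder [2 * M * h ^ 4 * N], integrated over a period and multiplied by [n / (2 * T)], is
   [M * N * T ^ 4 / n ^ 3]. *)
exists (T ^ 4 * (M * N)); intros n A Hn HA.
pose proof (average_area_le g n A c T Hn HA O Hg) as L.
assert (n0 : 0 < INR n) by (apply lt_0_INR; lia).
set (h := T / INR n) in *.
assert (h0 : 0 < h) by (apply Rdiv_lt_0_compat; lra).
set (I1 := RInt (fun u => snd (c u) * X1 u) 0 T).
set (I3 := RInt (fun u => snd (c u) * X3 u) 0 T).
assert (B : - 2 * h * I1 - h ^ 3 / 3 * I3 - T * (2 * M * h ^ 4 * N) <=
  RInt (fun u => snd (c u) * (fst (c (u - h)) - fst (c (u + h)))) 0 T).
{ unfold I1, I3.
  rewrite <- !RInt_mul by (intros; cont).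
  replace (T * (2 * M * h ^ 4 * N)) with (RInt (fun _ => 2 * M * h ^ 4 * N) 0 T)
    by (rewrite RInt_cst; eqR; ring).
  rewrite <- !RInt_sub by (intros; cont).
  apply RInt_le_cont; [lra|intros; cont..|].
  intros u.
  pose proof (central_taylor _ X1 X2 X3 X4 M u M0 H1 H2 H3 H4 HM h (Rlt_le _ _ h0)) as B.
  cbv beta in B.
  set (r := fst (c (u - h)) - fst (c (u + h)) + 2 * h * X1 u + h ^ 3 / 3 * X3 u) in B.
  assert (B2 : Rabs (r * snd (c u)) <= 2 * M * h ^ 4 * N).
  { rewrite Rabs_mult; apply Rmult_le_compat; try apply Rabs_pos; [exact B|apply HN]. }
  apply Rabs_le_between in B2.
  apply Rplus_le_reg_r with (- (-2 * h * (snd (c u) * X1 u) - h ^ 3 / 3 * (snd (c u) * X3 u) - 2 * M * h ^ 4 * N)).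
  unfold r in B2; lra. }
assert (L2 : INR n * (-2 * h * I1 - h ^ 3 / 3 * I3 - T * (2 * M * h ^ 4 * N)) <= 2 * A * T)
  by (eapply Rle_trans; [apply Rmult_le_compat_l; [lra|exact B]|exact L]).
apply Rmult_le_reg_l with (2 * T); [lra|].
replace (2 * T * A) with (2 * A * T) by ring.
apply Rle_trans with (2 := L2).
apply Req_le; unfold h; field; lra.
Qed.

(** Orders 0 and 1 of the expansion, in the form through which bounds on [A n] pass to the
    coefficients. *)
Lemma expansion_limits (A a : nat -> R) : even_asymptotic_expansion A a ->
  is_lim_seq A (a 0%nat) /\
  is_lim_seq (fun n => INR n ^ 2 * (A n - a 0%nat)) (a 1%nat).
Proof.
intros H; split.
- pose proof (H 0%nat) as H0.
  apply (is_lim_seq_ext (fun n => (INR n ^ (2 * 0) * (A n - sum_n (fun k => a k / INR n ^ (2 * k)) 0)) + a 0%nat)).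
  + intros n; rewrite sum_O; simpl; field.
  + replace (Finite (a 0%nat)) with (Finite (0 + a 0%nat)) by (f_equal; ring).
    apply is_lim_seq_plus'; [exact H0|apply is_lim_seq_const].
- pose proof (H 1%nat) as H1.
  apply (is_lim_seq_ext_loc (fun n => (INR n ^ (2 * 1) * (A n - sum_n (fun k => a k / INR n ^ (2 * k)) 1)) + a 1%nat)).
  + exists 1%nat; intros n Hn; rewrite sum_n_RS, sum_O.
    assert (0 < INR n) by (apply lt_0_INR; lia); simpl; field; lra.
  + replace (Finite (a 1%nat)) with (Finite (0 + a 1%nat)) by (f_equal; ring).
    apply is_lim_seq_plus'; [exact H1|apply is_lim_seq_const].
Qed.

Lemma is_lim_seq_div_pow (C : R) (k : nat) : is_lim_seq (fun n => C / INR n ^ S k) 0.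
Proof.
replace (Finite 0) with (Rbar_mult C 0) by (simpl; f_equal; ring).
apply (is_lim_seq_scal_l (fun n => / INR n ^ S k) C 0).
assert (L : is_lim_seq (fun n => / INR n) 0).
{ replace (Finite 0) with (Rbar_inv p_infty) by reflexivity.
  apply is_lim_seq_inv; [apply is_lim_seq_INR|discriminate]. }
induction k as [|k IH].
- apply (is_lim_seq_ext (fun n => / INR n)); [intros; simpl; now rewrite Rmult_1_r|exact L].
- apply (is_lim_seq_ext (fun n => / INR n * / INR n ^ S k)).
  + intros n; rewrite <- Rinv_mult; reflexivity.
  + replace (Finite 0) with (Finite (0 * 0)) by (f_equal; ring).
    now apply is_lim_seq_mult'.
Qed.

(** * The parametrization of Sas *)

(** The counterclockwise form of the hypothesis. The tangent inequality ranges over pairs in one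
    period and so contains injectivity: its expression vanishes when the two points coincide. *)
Definition positive_curve (g : point -> Prop) (x y dx dy : R -> R) (T : R) : Prop :=
  0 < T /\
  (forall t, is_derive x t (dx t)) /\ (forall t, is_derive y t (dy t)) /\
  (forall t, continuous dx t) /\ (forall t, continuous dy t) /\
  (forall t, x (t + T) = x t) /\ (forall t, y (t + T) = y t) /\
  (forall s t, s < t -> t < s + T -> 0 < dx s * (y t - y s) - dy s * (x t - x s)) /\
  (forall p, g p <-> exists t, (x t, y t) = p).

Lemma is_derive_opp_arg (f : R -> R) (t l : R) :
  is_derive f (- t) l -> is_derive (fun s => f (- s)) t (- l).
Proof.
intros H; evar_last; [apply (is_derive_Rcomp f (fun s => - s)); [apply H|]; deriv|ring].
Qed.

(* The pairs [s < t < s + T] form a connected set, so the curve lies on the same side of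
   all its tangents; reversing it if necessary, on the left. *)
Lemma strictly_convex_positive_curve (g : point -> Prop) :
  smooth_strictly_convex_closed_curve g ->
  exists x y dx dy T, positive_curve g x y dx dy T.
Proof.
intros (c & T & (HT & Sx & Sy & Nv & per & inj) & conv & Hg).
set (x := fun t => fst (c t)); set (y := fun t => snd (c t)).
set (dx := Derive x); set (dy := Derive y).
assert (Hx : forall t, is_derive x t (dx t)).
{ intros t; apply Derive_correct, (Sx 1%nat t). }
assert (Hy : forall t, is_derive y t (dy t)).
{ intros t; apply Derive_correct, (Sy 1%nat t). }
assert (Cdx : forall t, continuous dx t).
{ intros t; apply (ex_derive_continuous dx), (Sx 2%nat t). }
assert (Cdy : forall t, continuous dy t).
{ intros t; apply (ex_derive_continuous dy), (Sy 2%nat t). }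
pose proof (continuous_of_derive _ _ Hx) as Cx.
pose proof (continuous_of_derive _ _ Hy) as Cy.
assert (px : forall t, x (t + T) = x t) by (intros t; unfold x; now rewrite per).
assert (py : forall t, y (t + T) = y t) by (intros t; unfold y; now rewrite per).
assert (inj' : forall s t, s < t -> t < s + T -> c s <> c t).
{ intros s t L1 L2 E.
  destruct (period_shift_in T 0 s HT) as [k Hk].
  rewrite <- (period_Z _ c T k s per), <- (period_Z _ c T k t per) in E.
  destruct (Rlt_dec (t + IZR k * T) T) as [L|L].
  - apply inj in E; lra.
  - replace (t + IZR k * T) with ((t + IZR k * T - T) + T) in E by ring.
    rewrite per in E; apply inj in E; lra. }
set (F := fun s t => dx s * (y t - y s) - dy s * (x t - x s)).
assert (NZ : forall s t, s < t -> t < s + T -> F s t <> 0).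
{ intros s t L1 L2.
  assert (N : c t <> c s) by (apply not_eq_sym; now apply inj').
  assert (E : cross (velocity c s) (vec (c s) (c t)) = F s t) by reflexivity.
  rewrite <- E.
  destruct (conv s) as [P|P]; specialize (P t N); lra. }
assert (same : forall s t, s < t -> t < s + T -> 0 < F 0 (T / 2) * F s t).
{ intros s t H1 H2; apply Rnot_le_lt; intros H.
  set (K := fun l => F ((1 - l) * 0 + l * s) ((1 - l) * (T / 2) + l * t)).
  destruct (continuous_zero_between K 0 1) as (l & Hl & E).
  - intros l; unfold K, F; cont.
  - unfold K.
    replace ((1 - 0) * 0 + 0 * s) with 0 by ring.
    replace ((1 - 0) * (T / 2) + 0 * t) with (T / 2) by ring.
    replace ((1 - 1) * 0 + 1 * s) with s by ring.
    replace ((1 - 1) * (T / 2) + 1 * t) with t by ring.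
    exact H.
  - rewrite Rmin_left, Rmax_right in Hl by lra.
    revert E; apply NZ; nra. }
assert (pg : forall p, g p <-> exists t, (x t, y t) = p).
{ intros p; rewrite Hg; split; intros [t E]; exists t; rewrite <- E; unfold x, y;
    now rewrite <- surjective_pairing. }
destruct (Rlt_dec 0 (F 0 (T / 2))) as [P|P].
- exists x, y, dx, dy, T; unfold positive_curve; repeat (split; [assumption|]).
  split; [|assumption].
  intros s t H1 H2; specialize (same s t H1 H2); fold (F s t); nra.
- exists (fun t => x (- t)), (fun t => y (- t)), (fun t => - dx (- t)), (fun t => - dy (- t)), T.
  split; [exact HT|].
  split; [intros t; now apply is_derive_opp_arg|].
  split; [intros t; now apply is_derive_opp_arg|].
  split; [intros t; cont|].
  split; [intros t; cont|].
  split; [intros t; rewrite <- (px (- (t + T))); f_equal; ring|].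
  split; [intros t; rewrite <- (py (- (t + T))); f_equal; ring|].
  split.
  (* Reversal turns [s < t < s + T] into [- s < - t + T < - s + T], again an admissible pair. *)
  + intros s t H1 H2; specialize (same (- s) (- t + T)).
    unfold F in same at 2; rewrite px, py in same.
    specialize (same ltac:(lra) ltac:(lra)); nra.
  + intros p; rewrite pg; split; intros [t E]; exists (- t); rewrite <- E; f_equal; f_equal; ring.
Qed.

Lemma positive_near (f : R -> R) (s : R) : continuous f s -> 0 < f s ->
  exists d, 0 < d /\ forall t, Rabs (t - s) < d -> 0 < f t.
Proof.
intros C P.
destruct (C (fun z => 0 < z) (open_gt 0 (f s) P)) as [d Hd].
exists d; split; [apply cond_pos|intros t Ht; now apply Hd].
Qed.

Lemma is_derive_RInt_cont (f : R -> R) (a t : R) :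
  (forall t, continuous f t) -> is_derive (fun t => RInt f a t) t (f t).
Proof.
intros Hf; apply (is_derive_RInt f _ a); [|apply Hf].
exists (mkposreal 1 Rlt_0_1); intros b _.
apply (RInt_correct (V := R_CompleteNormedModule)); now apply ex_RInt_cont.
Qed.

Lemma increasing_inverse (f : R -> R) : (forall t, continuous f t) ->
  (forall s t, s < t -> f s < f t) -> (forall z, exists a b, f a <= z <= f b) ->
  exists h : R -> R, (forall z, continuous h z) /\ (forall z, f (h z) = z) /\ (forall t, h (f t) = t).
Proof.
intros Cf inc un.
assert (sur : forall z, exists t, f t = z).
{ intros z; destruct (un z) as (a & b & H1 & H2).
  destruct (continuous_zero_between (fun t => f t - z) a b) as (t & _ & E).
  - intros t; cont.
  - nra.
  - exists t; lra. }
set (h := fun z => proj1_sig (constructive_indefinite_description _ (sur z))).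
assert (fh : forall z, f (h z) = z).
{ intros z; exact (proj2_sig (constructive_indefinite_description _ (sur z))). }
clearbody h.
assert (inj : forall s t, f s = f t -> s = t).
{ intros s t E; destruct (Rtotal_order s t) as [L|[L|L]]; [|exact L|]; apply inc in L; lra. }
assert (refl : forall s t, f s < f t -> s < t).
{ intros s t L; destruct (Rtotal_order s t) as [L'|[L'|L']]; [exact L'|subst; lra|apply inc in L'; lra]. }
exists h; split; [|split; [exact fh|intros t; apply inj, fh]].
intros z P [e He].
pose proof (cond_pos e) as e0.
assert (L1 : f (h z - e / 2) < z) by (rewrite <- (fh z) at 2; apply inc; lra).
assert (L2 : z < f (h z + e / 2)) by (rewrite <- (fh z) at 1; apply inc; lra).
assert (d0 : 0 < Rmin (z - f (h z - e / 2)) (f (h z + e / 2) - z)) by (apply Rmin_pos; lra).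
exists (mkposreal _ d0); intros z' Hz.
apply He.
change (Rabs (z' - z) < Rmin (z - f (h z - e / 2)) (f (h z + e / 2) - z)) in Hz.
change (Rabs (h z' - h z) < e).
pose proof (Rmin_l (z - f (h z - e / 2)) (f (h z + e / 2) - z)).
pose proof (Rmin_r (z - f (h z - e / 2)) (f (h z + e / 2) - z)).
apply Rabs_lt_between in Hz.
assert (h z - e / 2 < h z') by (apply refl; rewrite fh; lra).
assert (h z' < h z + e / 2) by (apply refl; rewrite fh; lra).
apply Rabs_lt_between; lra.
Qed.

(** The inverse on an arc is extended continuously to the whole line, as the integration lemmas are
    stated for globally continuous functions. *)
Lemma decreasing_piece_inverse (x : R -> R) (a b : R) : a < b -> (forall t, continuous x t) ->
  (forall s t, a <= s -> s < t -> t <= b -> x t < x s) ->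
  exists h : R -> R, (forall z, continuous h z) /\ (forall t, a <= t <= b -> h (x t) = t).
Proof.
intros ab Cx dec.
(* [cl] clamps to [a, b]; adding [t - cl t] extends [- x] to an increasing bijection. *)
set (cl := fun t => (a + b + Rabs (t - a) - Rabs (t - b)) * / 2).
assert (Ccl : forall t, continuous cl t).
{ intros t; unfold cl; cont; apply continuous_Rabs_comp; cont. }
assert (clc : forall t, (t <= a /\ cl t = a) \/ (a <= t <= b /\ cl t = t) \/ (b <= t /\ cl t = b)).
{ intros t; unfold cl, Rabs; destruct (Rcase_abs (t - a)), (Rcase_abs (t - b)); lra. }
destruct (increasing_inverse (fun t => t - cl t - x (cl t))) as (h & Ch & _ & hf).
- intros t; cont.
- intros s t L.
  destruct (clc s) as [[S1 ->]|[[S1 ->]|[S1 ->]]], (clc t) as [[T1 ->]|[[T1 ->]|[T1 ->]]]; try lra.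
  + destruct (Req_dec a t) as [E|N]; [rewrite <- E; lra|pose proof (dec a t); lra].
  + pose proof (dec a b); lra.
  + pose proof (dec s t); lra.
  + destruct (Req_dec b s) as [E|N]; [rewrite <- E; lra|pose proof (dec s b); lra].
- intros z; exists (a - Rabs z - Rabs (x a)), (b + Rabs z + Rabs (x b)).
  pose proof (Rle_abs z); pose proof (Rle_abs (- z)) as Z; rewrite Rabs_Ropp in Z.
  pose proof (Rle_abs (x b)); pose proof (Rle_abs (- x a)) as Q; rewrite Rabs_Ropp in Q.
  pose proof (Rabs_pos z); pose proof (Rabs_pos (x a)); pose proof (Rabs_pos (x b)).
  assert (L1 : a - Rabs z - Rabs (x a) <= a) by lra.
  assert (L2 : b <= b + Rabs z + Rabs (x b)) by lra.
  assert (K1 : cl (a - Rabs z - Rabs (x a)) = a) by (destruct (clc (a - Rabs z - Rabs (x a))); lra).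
  assert (K2 : cl (b + Rabs z + Rabs (x b)) = b) by (destruct (clc (b + Rabs z + Rabs (x b))); lra).
  rewrite K1, K2; lra.
- exists (fun z => h (- z)); split; [intros z; cont|].
  intros t Ht; rewrite <- (hf t) at 2; f_equal.
  destruct (clc t) as [[S1 ->]|[[S1 ->]|[S1 ->]]]; try ring.
  + replace t with a by lra; ring.
  + replace t with b by lra; ring.
Qed.

Lemma RInt_comp_cont (f h dh : R -> R) (a b : R) :
  (forall t, continuous f t) -> (forall t, is_derive h t (dh t)) -> (forall t, continuous dh t) ->
  RInt (fun t => dh t * f (h t)) a b = RInt f (h a) (h b).
Proof.
intros Cf Dh Cdh; apply (RInt_comp f h dh a b); intros; [apply Cf|split; auto].
Qed.

Lemma RInt_of_derive (f df : R -> R) (a b : R) :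
  (forall t, is_derive f t (df t)) -> (forall t, continuous df t) -> RInt df a b = f b - f a.
Proof.
intros D C; apply is_RInt_unique, (is_RInt_derive f df a b); intros; [apply D|apply C].
Qed.

Lemma decreasing_of_derive (f df : R -> R) (a b : R) :
  (forall t, is_derive f t (df t)) -> (forall t, a < t < b -> df t < 0) ->
  forall s t, a <= s -> s < t -> t <= b -> f t < f s.
Proof.
intros D N s t H1 H2 H3.
destruct (MVT_cor2 f df s t H2) as (z & E & Hz).
- intros z _; apply is_derive_Reals, D.
- pose proof (N z ltac:(lra)); nra.
Qed.

(** Gluing at a point where two branches meet, whichever branch [f] follows nearby. *)
Lemma continuous_two_values (f f1 f2 : R -> R) (t : R) :
  continuous f1 t -> continuous f2 t -> f1 t = f2 t ->
  (forall s, f s = f1 s \/ f s = f2 s) -> continuous f t.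
Proof.
intros C1 C2 E H P HP.
assert (E1 : f t = f1 t) by (destruct (H t); lra).
assert (E2 : f t = f2 t) by lra.
pose proof HP as HP1; pose proof HP as HP2.
rewrite E1 in HP1; rewrite E2 in HP2.
apply C1 in HP1; apply C2 in HP2.
unfold filtermap in *.
generalize (filter_and _ _ HP1 HP2); apply filter_imp; intros s [A B].
now destruct (H s) as [->| ->].
Qed.

Lemma cos_sin_inj (s t : R) : s < t -> t < s + 2 * PI -> cos s = cos t -> sin s = sin t -> False.
Proof.
intros H1 H2 E1 E2.
assert (E : cos (t - s) = 1).
{ rewrite cos_minus, E1, E2; pose proof (sin2_cos2 t) as Q; unfold Rsqr in Q; lra. }
replace (t - s) with (2 * ((t - s) / 2)) in E by field.
rewrite cos_2a_sin in E.
assert (0 < sin ((t - s) / 2)) by (apply sin_gt_0; lra).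
nra.
Qed.

Section PositiveCurve.
Variables (g : point -> Prop) (x y dx dy : R -> R) (T : R).
Hypothesis PC : positive_curve g x y dx dy T.

Let HT : 0 < T := proj1 PC.
Let Hx : forall t, is_derive x t (dx t) := proj1 (proj2 PC).
Let Hy : forall t, is_derive y t (dy t) := proj1 (proj2 (proj2 PC)).
Let Cdx : forall t, continuous dx t := proj1 (proj2 (proj2 (proj2 PC))).
Let Cdy : forall t, continuous dy t := proj1 (proj2 (proj2 (proj2 (proj2 PC)))).
Let px : forall t, x (t + T) = x t := proj1 (proj2 (proj2 (proj2 (proj2 (proj2 PC))))).
Let py : forall t, y (t + T) = y t := proj1 (proj2 (proj2 (proj2 (proj2 (proj2 (proj2 PC)))))).
Let conv : forall s t, s < t -> t < s + T -> 0 < dx s * (y t - y s) - dy s * (x t - x s) :=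
  proj1 (proj2 (proj2 (proj2 (proj2 (proj2 (proj2 (proj2 PC))))))).
Let Hg : forall p, g p <-> exists t, (x t, y t) = p :=
  proj2 (proj2 (proj2 (proj2 (proj2 (proj2 (proj2 (proj2 PC))))))).
Let Cx := continuous_of_derive _ _ Hx.
Let Cy := continuous_of_derive _ _ Hy.

Lemma positive_tangent (s : R) (p : point) : g p -> p <> (x s, y s) ->
  0 < dx s * (snd p - y s) - dy s * (fst p - x s).
Proof.
intros G N; destruct (proj1 (Hg p) G) as [t E].
destruct (period_shift_in T s t HT) as [k Hk].
set (t' := t + IZR k * T) in *.
assert (E1 : x t' = x t) by (apply (period_Z _ x T k t px)).
assert (E2 : y t' = y t) by (apply (period_Z _ y T k t py)).
rewrite <- E, <- E1, <- E2 in N |- *; cbn [fst snd].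
destruct (Req_dec s t') as [Q|Q]; [exfalso; apply N; now rewrite Q|].
apply conv; lra.
Qed.

(* A collinear triple has a middle point, whose tangent line would have the other
   two points on opposite sides. *)
Lemma no_three_collinear (p q r : point) : g p -> g q -> g r ->
  p <> q -> q <> r -> p <> r -> orient p q r <> 0.
Proof.
(* With [q] strictly between [p] and [r], a positive combination of the two tangent inequalities at
   [q] is zero. *)
assert (mid : forall p q r l m, g p -> g q -> g r -> p <> q -> r <> q -> 0 < l -> 0 < m ->
  l * (fst p - fst q) + m * (fst r - fst q) = 0 ->
  l * (snd p - snd q) + m * (snd r - snd q) = 0 -> False).
{ intros a b d l m Ga Gb Gd N1 N2 Hl Hm E1 E2.
  destruct (proj1 (Hg b) Gb) as [s E].
  rewrite <- E in N1, N2, E1, E2; cbn [fst snd] in E1, E2.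
  pose proof (positive_tangent s a Ga N1) as P1.
  pose proof (positive_tangent s d Gd N2) as P2.
  assert (P3 := Rmult_lt_0_compat _ _ Hl P1).
  assert (P4 := Rmult_lt_0_compat _ _ Hm P2).
  assert (E3 : l * (dx s * (snd a - y s) - dy s * (fst a - x s)) +
    m * (dx s * (snd d - y s) - dy s * (fst d - x s)) =
    dx s * (l * (snd a - y s) + m * (snd d - y s)) -
    dy s * (l * (fst a - x s) + m * (fst d - x s))) by ring.
  rewrite E1, E2 in E3; lra. }
intros Gp Gq Gr N1 N2 N3 Z.
destruct p as [p1 p2], q as [q1 q2], r as [r1 r2].
unfold orient, cross, vec in Z; cbn [fst snd] in Z.
set (u1 := q1 - p1) in *; set (u2 := q2 - p2) in *.
set (v1 := r1 - p1) in *; set (v2 := r2 - p2) in *.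
assert (U : 0 < u1 * u1 + u2 * u2).
{ destruct (Req_dec u1 0) as [A|A], (Req_dec u2 0) as [B|B]; try nra.
  exfalso; apply N1; f_equal; unfold u1, u2 in *; lra. }
(* On the common line, [r] has the coordinate [d / w] when [p] has 0 and [q] has 1; this decides
   which point is in the middle. *)
set (d := u1 * v1 + u2 * v2).
assert (V1 : (u1 * u1 + u2 * u2) * v1 = d * u1).
{ replace ((u1 * u1 + u2 * u2) * v1) with (d * u1 - u2 * (u1 * v2 - u2 * v1)) by (unfold d; ring).
  rewrite Z; ring. }
assert (V2 : (u1 * u1 + u2 * u2) * v2 = d * u2).
{ replace ((u1 * u1 + u2 * u2) * v2) with (d * u2 + u1 * (u1 * v2 - u2 * v1)) by (unfold d; ring).
  rewrite Z; ring. }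
set (w := u1 * u1 + u2 * u2) in *.
destruct (Rtotal_order d 0) as [D|[D|D]].
- apply (mid (q1, q2) (p1, p2) (r1, r2) (- d) w); cbn [fst snd]; auto; try lra;
    fold u1 u2 v1 v2; lra.
- apply N3; f_equal.
  + assert (v1 = 0) by (apply Rmult_eq_reg_l with w; [rewrite V1, D; ring|lra]); unfold v1 in *; lra.
  + assert (v2 = 0) by (apply Rmult_eq_reg_l with w; [rewrite V2, D; ring|lra]); unfold v2 in *; lra.
- destruct (Rtotal_order d w) as [D'|[D'|D']].
  + apply (mid (p1, p2) (r1, r2) (q1, q2) (w - d) d); cbn [fst snd]; auto; try lra.
    * replace (p1 - r1) with (- v1) by (unfold v1; ring).
      replace (q1 - r1) with (u1 - v1) by (unfold u1, v1; ring); nra.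
    * replace (p2 - r2) with (- v2) by (unfold v2; ring).
      replace (q2 - r2) with (u2 - v2) by (unfold u2, v2; ring); nra.
  + apply N2; f_equal.
    * assert (v1 = u1) by (apply Rmult_eq_reg_l with w; [rewrite V1, D'; ring|lra]); unfold u1, v1 in *; lra.
    * assert (v2 = u2) by (apply Rmult_eq_reg_l with w; [rewrite V2, D'; ring|lra]); unfold u2, v2 in *; lra.
  + apply (mid (p1, p2) (q1, q2) (r1, r2) (d - w) w); cbn [fst snd]; auto; try lra.
    * replace (p1 - q1) with (- u1) by (unfold u1; ring).
      replace (r1 - q1) with (v1 - u1) by (unfold u1, v1; ring); nra.
    * replace (p2 - q2) with (- u2) by (unfold u2; ring).
      replace (r2 - q2) with (v2 - u2) by (unfold u2, v2; ring); nra.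
Qed.

(** Collinearity concerns the points and not their parametrization, so a continuous loop in [g] that
    is injective on each period inherits it. *)
Lemma oval_in_curve (Q : R -> point) (U : R) : 0 < U ->
  (forall t, continuous (fun s => fst (Q s)) t) ->
  (forall t, continuous (fun s => snd (Q s)) t) ->
  (forall t, Q (t + U) = Q t) -> (forall t, g (Q t)) ->
  (forall s t, s < t -> t < s + U -> Q s <> Q t) -> oval Q U.
Proof.
intros HU C1 C2 per G inj; repeat (split; [assumption|]).
intros r s t H1 H2 H3; apply no_three_collinear; try apply G; apply inj; lra.
Qed.

Lemma positive_curve_oval : oval (fun t => (x t, y t)) T.
Proof.
apply oval_in_curve; cbn [fst snd]; auto.
- intros t; now rewrite px, py.
- intros t; apply Hg; now exists t.
- intros s t H1 H2 E; injection E as E1 E2.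
  pose proof (conv s t H1 H2) as P; rewrite E1, E2 in P; lra.
Qed.

(** The sign is constant, so one triple decides it: 0, [T / 2] and a parameter just beyond. As the
    third point leaves the second, the orientation starts from 0 with a derivative that is the
    tangent expression at [T / 2]. *)
Lemma positive_curve_orient (r s t : R) : r < s -> s < t -> t < r + T ->
  0 < orient (x r, y r) (x s, y s) (x t, y t).
Proof.
destruct (oval_orient_sign _ _ positive_curve_oval) as (e & [->|He] & H).
{ intros H1 H2 H3; specialize (H r s t H1 H2 H3); lra. }
exfalso; clear r s t.
set (F := fun t => (x (T / 2) - x 0) * (y t - y 0) - (x t - x 0) * (y (T / 2) - y 0)).
set (F' := fun t => (x (T / 2) - x 0) * dy t - dx t * (y (T / 2) - y 0)).
destruct (positive_near F' (T / 2)) as (d & Hd & P).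
- unfold F'; cont.
- specialize (conv (T / 2) (0 + T) ltac:(lra) ltac:(lra)).
  rewrite px, py in conv; unfold F'; lra.
- set (t := T / 2 + Rmin (d / 2) (T / 4)).
  assert (M1 : 0 < Rmin (d / 2) (T / 4)) by (apply Rmin_pos; lra).
  pose proof (Rmin_l (d / 2) (T / 4)) as M2; pose proof (Rmin_r (d / 2) (T / 4)) as M3.
  destruct (MVT_gen F (T / 2) t F') as (z & Hz & E).
  + intros z _; unfold F, F'; evar_last.
    * deriv.
    * cbv beta; ring.
  + intros z _; apply continuity_pt_filterlim; change (continuous F z); unfold F; cont.
  + rewrite Rmin_left, Rmax_right in Hz by (unfold t; lra).
    assert (Pz : 0 < F' z) by (apply P; rewrite Rabs_pos_eq; unfold t in *; lra).
    specialize (H 0 (T / 2) t ltac:(lra) ltac:(unfold t; lra) ltac:(unfold t; lra)).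
    assert (E2 : F t = orient (x 0, y 0) (x (T / 2), y (T / 2)) (x t, y t))
      by (unfold F, orient, cross, vec; cbn [fst snd]; ring).
    assert (E3 : F (T / 2) = 0) by (unfold F; ring).
    rewrite <- E2, He in H; rewrite E3 in E.
    assert (0 < F' z * (t - T / 2)) by (apply Rmult_lt_0_compat; unfold t; lra).
    lra.
Qed.

(** Twice the rate at which the ray from the origin sweeps area. *)
Let w := fun u => x u * dy u - y u * dx u.

Lemma continuous_w t : continuous w t.
Proof. unfold w; cont. Qed.

(** A chord triangle has at most the area of its sector: the derivative in [t] of twice the
    difference is the tangent expression at [t] for the fixed end of the chord. *)
Lemma max_area_le_sector (n : nat) (A : R) : (3 <= n)%nat -> is_max_inscribed_area g n A ->
  A <= RInt w 0 T / 2.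
Proof.
intros Hn [(v & Sv & Iv & <-) _].
pose proof continuous_w as Cw.
assert (pw : forall t, w (t + T) = w t).
{ assert (pd : forall f f' : R -> R, (forall t, is_derive f t (f' t)) -> (forall t, f (t + T) = f t) ->
    forall t, f' (t + T) = f' t).
  { intros f f' Hf pf t.
    assert (D : is_derive (fun t => f (t + T)) t (f' (t + T))).
    { evar_last; [deriv|ring]. }
    apply (is_derive_ext _ f) in D; [|exact pf].
    rewrite <- (is_derive_unique _ _ _ D); apply is_derive_unique, Hf. }
  intros t; unfold w; now rewrite px, py, (pd x dx Hx px), (pd y dy Hy py). }
replace (RInt w 0 T / 2) with ((RInt w 0 T + INR n * 0) / 2) by (eqR; field).
apply (simple_polygon_area_le (fun t => (x t, y t)) T (RInt w 0 T) 0 (fun t => RInt w 0 t)); auto.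
- exact positive_curve_oval.
- exact positive_curve_orient.
- intros t.
  rewrite <- (RInt_split w 0 t (t + T) Cw); f_equal.
  rewrite <- (RInt_periodic w T t Cw pw), (RInt_shift w 0 T t Cw).
  f_equal; ring.
- intros s t H1 H2; rewrite Rplus_0_r.
  set (F := fun t => RInt w 0 t - (x s * y t - x t * y s)).
  destruct (MVT_gen F s t (fun u => w u - (x s * dy u - dx u * y s))) as (z & Hz & E).
  + intros z _; unfold F; evar_last.
    * pose proof (fun t => is_derive_RInt_cont w 0 t Cw) as D; deriv.
    * cbv beta; ring.
  + intros z _; apply continuity_pt_filterlim; change (continuous F z); unfold F.
    pose proof (fun t => is_derive_RInt_cont w 0 t Cw) as D.
    pose proof (continuous_of_derive _ _ D); cont.
  + rewrite Rmin_left, Rmax_right in Hz by lra.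
    assert (P : 0 <= w z - (x s * dy z - dx z * y s)).
    { destruct (Req_dec z s) as [->|N]; [unfold w; apply Req_le; ring|].
      pose proof (conv z (s + T) ltac:(lra) ltac:(lra)) as P.
      rewrite px, py in P; unfold w; lra. }
    assert (P2 : 0 <= (w z - (x s * dy z - dx z * y s)) * (t - s)) by (apply Rmult_le_pos; lra).
    assert (F0 : F s = RInt w 0 s) by (unfold F; eqR; ring).
    rewrite <- E, F0 in P2; unfold F in P2.
    unfold cross; cbn [fst snd]; lra.
- intros i Hi; apply Hg; now apply Iv.
Qed.

(** Where [dx] vanishes the tangent is vertical, so by strict convexity the abscissa has there a
    strict extremum over the period. This cannot happen strictly between the maximum [a] and the
    minimum [b], hence [dx] keeps its sign on each arc. *)
Lemma abscissa_extrema : exists a b, a < b < a + T /\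
  (forall t, x t <= x a) /\ (forall t, x b <= x t) /\ x b < x a /\
  (forall s t, a <= s -> s < t -> t <= b -> x t < x s) /\
  (forall s t, b <= s -> s < t -> t <= a + T -> x s < x t).
Proof.
assert (Cp : forall t, continuity_pt x t) by (intros; apply continuity_pt_filterlim, Cx).
assert (glob : forall t0 t, exists t', t0 <= t' < t0 + T /\ x t' = x t).
{ intros t0 t; destruct (period_shift_in T t0 t HT) as [k Hk].
  exists (t + IZR k * T); split; [exact Hk|apply (period_Z _ x T k t px)]. }
destruct (continuity_ab_maj x 0 T) as (a & Ha & _); [lra|auto|].
assert (Ma : forall t, x t <= x a).
{ intros t; destruct (glob 0 t) as (t' & Ht & <-); apply Ha; lra. }
destruct (continuity_ab_min x a (a + T)) as (b & Hb & Ib); [lra|auto|].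
assert (Mb : forall t, x b <= x t).
{ intros t; destruct (glob a t) as (t' & Ht & <-); apply Hb; lra. }
assert (Lab : x b < x a).
{ destruct (Rle_lt_or_eq_dec _ _ (Ma b)) as [L|E]; [exact L|exfalso].
  assert (K : forall t, x t = x a) by (intros t; specialize (Ma t); specialize (Mb t); lra).
  assert (dx0 : forall t, dx t = 0).
  { intros t; rewrite <- (is_derive_unique _ _ _ (Hx t)).
    rewrite (Derive_ext x (fun _ => x a)) by exact K; apply Derive_const. }
  pose proof (conv 0 (T / 2) ltac:(lra) ltac:(lra)) as P.
  rewrite dx0, (K (T / 2)), (K 0) in P; lra. }
assert (Iab : a < b < a + T).
{ split.
  - destruct (Req_dec a b) as [E|N]; [rewrite E in Lab|]; lra.
  - destruct (Req_dec b (a + T)) as [E|N]; [rewrite E, px in Lab|]; lra. }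
exists a, b; split; [exact Iab|].
split; [exact Ma|split; [exact Mb|split; [exact Lab|]]].
assert (crit : forall s, dx s = 0 ->
   (forall t, s < t < s + T -> x t < x s) \/ (forall t, s < t < s + T -> x s < x t)).
{ intros s E; destruct (Rlt_dec 0 (dy s)) as [P|P].
  - left; intros t Ht; pose proof (conv s t (proj1 Ht) (proj2 Ht)) as Q; rewrite E in Q.
    apply Rnot_le_lt; intros K; nra.
  - right; intros t Ht; pose proof (conv s t (proj1 Ht) (proj2 Ht)) as Q; rewrite E in Q.
    apply Rnot_le_lt; intros K; nra. }
(* Without zeros, [dx] has everywhere the sign of the mean slope; [e] selects the direction. *)
assert (sgn : forall p q (e : R), p < q -> (e = 1 \/ e = -1) -> (forall s, p < s < q -> dx s <> 0) ->
   e * x q < e * x p -> forall s, p < s < q -> e * dx s < 0).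
{ intros p q e pq He NZ L s Hs.
  destruct (MVT_cor2 x dx p q pq) as (z & E & Hz).
  { intros z _; apply is_derive_Reals, Hx. }
  assert (Nz : e * dx z < 0).
  { apply Rnot_le_lt; intros K; assert (0 <= (e * dx z) * (q - p)) by (apply Rmult_le_pos; lra).
    nra. }
  apply Rnot_le_lt; intros K.
  destruct (continuous_zero_between dx z s Cdx) as (u & Hu & E0).
  { destruct He as [-> | ->]; nra. }
  apply (NZ u); [|exact E0].
  unfold Rmin, Rmax in Hu; destruct (Rle_dec z s); lra. }
split.
- apply decreasing_of_derive with dx; [exact Hx|].
  intros t Ht; enough (1 * dx t < 0) by lra; revert t Ht.
  apply sgn; [lra|now left| |lra].
  intros s Hs E; destruct (crit s E) as [P|P].
  + pose proof (P (a + T) ltac:(lra)) as Q; rewrite px in Q; pose proof (Ma s); lra.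
  + pose proof (P b ltac:(lra)) as Q; pose proof (Mb s); lra.
- intros s t H1 H2 H3.
  enough (- x t < - x s) by lra.
  apply (decreasing_of_derive (fun t => - x t) (fun t => - dx t) b (a + T)); try assumption.
  + intros u; now apply is_derive_Ropp.
  + intros u Hu; enough ((-1) * dx u < 0) by lra; revert u Hu.
    apply sgn; [lra|now right| |rewrite px; lra].
    intros u Hu E; destruct (crit u E) as [P|P].
    * pose proof (P (a + T) ltac:(lra)) as Q; rewrite px in Q; pose proof (Ma u); lra.
    * pose proof (P (b + T) ltac:(lra)) as Q; rewrite px in Q; pose proof (Mb u); lra.
Qed.

Lemma sector_area : RInt (fun u => x u * dy u - y u * dx u) 0 T / 2 = - RInt (fun u => dx u * y u) 0 T.
Proof.
assert (E : RInt (fun u => dx u * y u + x u * dy u) 0 T = 0).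
{ rewrite (RInt_of_derive (fun u => x u * y u)).
  - pose proof (px 0) as E1; pose proof (py 0) as E2; rewrite Rplus_0_l in E1, E2.
    rewrite E1, E2; eqR; ring.
  - intros t; deriv.
  - intros t; cont. }
rewrite RInt_add in E by (intros; cont).
rewrite RInt_sub by (intros; cont).
rewrite (RInt_ext (fun u => y u * dx u) (fun u => dx u * y u)) by (intros; apply Rmult_comm).
lra.
Qed.

(** The extrema of the abscissa cut the curve into two graphs over [[m - r, m + r]]. The angle [t]
    follows one where [sin t >= 0] and the other where [sin t <= 0]; they meet where [sin t = 0]. *)
Lemma sas_parametrization_aux : exists m r f,
  0 < r /\ (forall t, continuous f t) /\ (forall t, f (t + 2 * PI) = f t) /\
  (forall p, g p <-> exists t, (m + r * cos t, f t) = p) /\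
  (forall s t, s < t -> t < s + 2 * PI -> (m + r * cos s, f s) <> (m + r * cos t, f t)) /\
  RInt (fun u => x u * dy u - y u * dx u) 0 T / 2 = r * RInt (fun t => f t * sin t) 0 (2 * PI).
Proof.
destruct abscissa_extrema as (a & b & Iab & Ma & Mb & Lab & dec & inc).
destruct (decreasing_piece_inverse x a b) as (h1 & C1 & E1); [lra|exact Cx|exact dec|].
destruct (decreasing_piece_inverse (fun t => - x t) b (a + T)) as (h2' & C2' & E2');
  [lra|intros; cont|intros s t K1 K2 K3; specialize (inc s t K1 K2 K3); lra|].
set (h2 := fun z => h2' (- z)).
assert (C2 : forall t, continuous h2 t) by (intros; unfold h2; cont).
assert (E2 : forall t, b <= t <= a + T -> h2 (x t) = t) by (intros; now apply E2').
clearbody h2; clear h2' C2' E2'.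
set (m := (x a + x b) / 2); set (r := (x a - x b) / 2).
set (X := fun t => m + r * cos t).
assert (r0 : 0 < r) by (unfold r; lra).
assert (HX : forall t, x b <= X t <= x a).
{ intros t; pose proof (COS_bound t); unfold X.
  replace (x b) with (m - r) by (unfold m, r; field).
  replace (x a) with (m + r) by (unfold m, r; field). nra. }
assert (reach : forall p q z, p < q -> (x p - z) * (x q - z) <= 0 -> exists t, p <= t <= q /\ x t = z).
{ intros p q z pq L.
  destruct (continuous_zero_between (fun t => x t - z) p q) as (t & Ht & E);
    [intros; cont|exact L|].
  rewrite Rmin_left, Rmax_right in Ht by lra.
  exists t; split; [exact Ht|lra]. }
assert (H1 : forall z, x b <= z <= x a -> a <= h1 z <= b /\ x (h1 z) = z).
{ intros z Hz; destruct (reach a b z) as (t & Ht & <-); [lra|nra|].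
  rewrite E1 by exact Ht; auto. }
assert (H2 : forall z, x b <= z <= x a -> b <= h2 z <= a + T /\ x (h2 z) = z).
{ intros z Hz; destruct (reach b (a + T) z) as (t & Ht & <-); [lra|rewrite px; nra|].
  rewrite E2 by exact Ht; auto. }
set (f1 := fun t => y (h1 (X t))); set (f2 := fun t => y (h2 (X t))).
set (f := fun t => if Rle_dec 0 (sin t) then f1 t else f2 t).
assert (CX : forall t, continuous X t) by (intros; unfold X; cont).
assert (Cf1 : forall t, continuous f1 t) by (intros; unfold f1; cont).
assert (Cf2 : forall t, continuous f2 t) by (intros; unfold f2; cont).
assert (glue : forall t, sin t = 0 -> f1 t = f2 t).
{ intros t S; pose proof (sin2_cos2 t) as Q; rewrite S in Q; unfold Rsqr in Q.
  unfold f1, f2; assert (Q2 : (cos t - 1) * (cos t + 1) = 0) by lra.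
  apply Rmult_integral in Q2; destruct Q2 as [Q2|Q2].
  - replace (X t) with (x a) by (unfold X, m, r; replace (cos t) with 1 by lra; field).
    rewrite E1 by lra. rewrite <- (px a), E2 by lra. now rewrite py.
  - replace (X t) with (x b) by (unfold X, m, r; replace (cos t) with (-1) by lra; field).
    now rewrite E1, E2 by lra. }
assert (fp : forall t, 0 <= sin t -> f t = f1 t).
{ intros t S; unfold f; destruct (Rle_dec 0 (sin t)); [reflexivity|contradiction]. }
assert (fn : forall t, sin t <= 0 -> f t = f2 t).
{ intros t S; unfold f; destruct (Rle_dec 0 (sin t)); [apply glue; lra|reflexivity]. }
assert (f12 : forall t, f t = f1 t \/ f t = f2 t).
{ intros t; unfold f; destruct (Rle_dec 0 (sin t)); auto. }
assert (Cf : forall t, continuous f t).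
{ intros t; destruct (Rtotal_order (sin t) 0) as [L|[L|L]].
  - apply (continuous_ext_loc _ f2); [|apply Cf2].
    destruct (positive_near (fun s => - sin s) t) as (d & Hd & K); [cont|lra|].
    exists (mkposreal d Hd); intros s Hs; symmetry; apply fn.
    specialize (K s Hs); lra.
  - apply continuous_two_values with f1 f2; auto.
  - apply (continuous_ext_loc _ f1); [|apply Cf1].
    destruct (positive_near sin t) as (d & Hd & K); [apply continuous_sin|lra|].
    exists (mkposreal d Hd); intros s Hs; symmetry; apply fp.
    specialize (K s Hs); lra. }
(* The strict inequalities record the open arc containing the point; injectivity needs them for
   angles with equal cosines and opposite sines. *)
assert (on : forall t, exists u, a <= u <= a + T /\ X t = x u /\ f t = y u /\
   (0 < sin t -> u < b) /\ (sin t < 0 -> b < u < a + T)).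
{ intros t.
  assert (st : sin t <> 0 -> -1 < cos t < 1).
  { intros S; pose proof (sin2_cos2 t) as Q; unfold Rsqr in Q.
    assert (0 < sin t * sin t) by nra. nra. }
  destruct (Rle_dec 0 (sin t)) as [S|S].
  - destruct (H1 (X t) (HX t)) as [Q1 Q2].
    exists (h1 (X t)); split; [lra|]; split; [now symmetry|]; split; [now apply fp|].
    split; [|lra]. intros S'; destruct (Req_dec (h1 (X t)) b) as [E|N]; [exfalso|lra].
    rewrite E in Q2; specialize (st ltac:(lra)); unfold X, m, r in Q2; nra.
  - destruct (H2 (X t) (HX t)) as [Q1 Q2].
    exists (h2 (X t)); split; [lra|]; split; [now symmetry|]; split; [apply fn; lra|].
    split; [lra|intros S']. specialize (st ltac:(lra)).
    split.
    + destruct (Req_dec (h2 (X t)) b) as [E|N]; [exfalso|lra].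
      rewrite E in Q2; unfold X, m, r in Q2; nra.
    + destruct (Req_dec (h2 (X t)) (a + T)) as [E|N]; [exfalso|lra].
      rewrite E, px in Q2; unfold X, m, r in Q2; nra. }
exists m, r, f; split; [exact r0|split; [exact Cf|]].
split; [|split; [|split]].
- intros t; unfold f, f1, f2, X; rewrite sin_plus, cos_plus, sin_2PI, cos_2PI.
  now replace (sin t * 1 + cos t * 0) with (sin t) by ring;
    replace (cos t * 1 - sin t * 0) with (cos t) by ring.
- intros p; rewrite Hg; split; intros [t E].
  + destruct (period_shift_in T a t HT) as [k Hk].
    set (u := t + IZR k * T) in *.
    assert (Eu : (x u, y u) = p) by (rewrite <- E; unfold u; now rewrite !period_Z).
    assert (cb : -1 <= (x u - m) / r <= 1).
    { specialize (Ma u); specialize (Mb u); unfold m, r in *.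
      split; [apply Rle_div_r|apply Rle_div_l]; lra. }
    assert (XE : forall s, cos s = (x u - m) / r -> X s = x u).
    { intros s Hs; unfold X; rewrite Hs; field; lra. }
    pose proof (acos_bound ((x u - m) / r)) as [A1 A2].
    pose proof (cos_acos _ cb) as A3.
    assert (S0 : 0 <= sin (acos ((x u - m) / r))) by (apply sin_ge_0; lra).
    destruct (Rle_dec u b) as [L|L].
    * exists (acos ((x u - m) / r)).
      rewrite fp by exact S0; unfold f1; fold (X (acos ((x u - m) / r))).
      rewrite XE by exact A3; rewrite E1 by lra; exact Eu.
    * exists (- acos ((x u - m) / r)).
      rewrite fn by (rewrite sin_neg; lra).
      unfold f2; fold (X (- acos ((x u - m) / r))).
      rewrite XE by (rewrite cos_neg; exact A3); rewrite E2 by lra; exact Eu.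
  + destruct (on t) as (u & _ & Q1 & Q2 & _).
    exists u; rewrite <- Q1, <- Q2; exact E.
- intros s t L1 L2 E; injection E as Ec Ef.
  assert (Ecos : cos s = cos t) by (apply Rmult_eq_reg_l with r; lra).
  destruct (on s) as (u & Iu & Xu & Yu & Up & Un), (on t) as (v & Iv & Xv & Yv & Vp & Vn).
  assert (Sq : (sin s - sin t) * (sin s + sin t) = 0).
  { pose proof (sin2_cos2 s) as Q1; pose proof (sin2_cos2 t) as Q2; unfold Rsqr in Q1, Q2.
    rewrite Ecos in Q1; lra. }
  destruct (Req_dec (sin s) (sin t)) as [Es|Ns].
  { exact (cos_sin_inj s t L1 L2 Ecos Es). }
  assert (sin s + sin t = 0) by (apply Rmult_integral in Sq; lra).
  assert (inj : forall u v, u < v -> v < u + T -> x u = x v -> y u = y v -> False).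
  { intros p q P1 P2 P3 P4; pose proof (conv p q P1 P2) as P; rewrite P3, P4 in P; lra. }
  assert (Exy : x u = x v /\ y u = y v).
  { rewrite <- Xu, <- Xv, <- Yu, <- Yv; split; [unfold X; now rewrite Ecos|exact Ef]. }
  destruct Exy as [Exx Eyy].
  destruct (Rlt_dec 0 (sin s)) as [S|S].
  + specialize (Up S); specialize (Vn ltac:(lra)); apply (inj u v); lra.
  + specialize (Un ltac:(lra)); specialize (Vp ltac:(lra)); apply (inj v u); lra.
- rewrite sector_area.
  assert (Py : forall t, dx (t + T) = dx t).
  { intros t; assert (D : is_derive (fun t => x (t + T)) t (dx (t + T))) by (evar_last; [deriv|ring]).
    apply (is_derive_ext _ x) in D; [|exact px].
    rewrite <- (is_derive_unique _ _ _ D); apply is_derive_unique, Hx. }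
  rewrite <- (RInt_periodic (fun u => dx u * y u) T a) by
    (intros; first [solve [cont] | now rewrite Py, py]).
  rewrite (RInt_shift (fun u => dx u * y u)) by (intros; cont).
  rewrite Rplus_0_l, (Rplus_comm T a).
  pose proof PI_RGT_0 as pi0.
  rewrite <- (RInt_split _ a b) by (intros; cont).
  rewrite <- (RInt_split _ 0 PI) by (intros; cont).
  assert (DX : forall t, is_derive X t (- r * sin t)).
  { intros t; unfold X; evar_last; [deriv|ring]. }
  assert (CDX : forall t, continuous (fun t => - r * sin t) t) by (intros; cont).
  (* On each arc both integrals reduce, by the substitutions [z = x u] and [z = X t], to the
     integral of the graph over the abscissa. *)
  assert (half1 : RInt (fun u => dx u * y u) a b = - r * RInt (fun t => f t * sin t) 0 PI).
  { rewrite <- RInt_mul by (intros; cont).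
    rewrite (RInt_ext (fun t => - r * (f t * sin t)) (fun t => - r * sin t * y (h1 (X t)))).
    - rewrite (RInt_comp_cont (fun z => y (h1 z)) X) by (intros; auto; cont).
      replace (X 0) with (x a) by (unfold X, m, r; rewrite cos_0; field).
      replace (X PI) with (x b) by (unfold X, m, r; rewrite cos_PI; field).
      rewrite <- (RInt_comp_cont (fun z => y (h1 z)) x dx) by (intros; auto; cont).
      apply RInt_ext; intros t Ht; rewrite Rmin_left, Rmax_right in Ht by lra.
      now rewrite E1 by lra.
    - intros t Ht; rewrite Rmin_left, Rmax_right in Ht by lra.
      rewrite fp by (apply Rlt_le, sin_gt_0; lra); unfold f1; eqR; ring. }
  assert (half2 : RInt (fun u => dx u * y u) b (a + T) = - r * RInt (fun t => f t * sin t) PI (2 * PI)).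
  { rewrite <- RInt_mul by (intros; cont).
    rewrite (RInt_ext (fun t => - r * (f t * sin t)) (fun t => - r * sin t * y (h2 (X t)))).
    - rewrite (RInt_comp_cont (fun z => y (h2 z)) X) by (intros; auto; cont).
      replace (X PI) with (x b) by (unfold X, m, r; rewrite cos_PI; field).
      replace (X (2 * PI)) with (x (a + T)) by (rewrite px; unfold X, m, r; rewrite cos_2PI; field).
      rewrite <- (RInt_comp_cont (fun z => y (h2 z)) x dx) by (intros; auto; cont).
      apply RInt_ext; intros t Ht; rewrite Rmin_left, Rmax_right in Ht by lra.
      now rewrite E2 by lra.
    - intros t Ht; rewrite Rmin_left, Rmax_right in Ht by lra.
      rewrite fn by (apply Rlt_le, sin_lt_0; lra); unfold f2; eqR; ring. }
  rewrite half1, half2; eqR; ring.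
Qed.

End PositiveCurve.

(** From here on the curve enters only through the continuous function [f], the criterion for ovals
    and the upper bound by the area. *)
Lemma sas_parametrization (g : point -> Prop) : smooth_strictly_convex_closed_curve g ->
  exists m r f, 0 < r /\ (forall t, continuous f t) /\ (forall t, f (t + 2 * PI) = f t) /\
    (forall p, g p <-> exists t, (m + r * cos t, f t) = p) /\
    (forall Q U, 0 < U -> (forall t, continuous (fun s => fst (Q s)) t) ->
      (forall t, continuous (fun s => snd (Q s)) t) ->
      (forall t, Q (t + U) = Q t) -> (forall t, g (Q t)) ->
      (forall s t, s < t -> t < s + U -> Q s <> Q t) -> oval Q U) /\
    (forall s t, s < t -> t < s + 2 * PI -> (m + r * cos s, f s) <> (m + r * cos t, f t)) /\
    (forall n A, (3 <= n)%nat -> is_max_inscribed_area g n A ->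
       A <= r * RInt (fun t => f t * sin t) 0 (2 * PI)).
Proof.
intros H; destruct (strictly_convex_positive_curve g H) as (x & y & dx & dy & T & PC).
destruct (sas_parametrization_aux g x y dx dy T PC) as (m & r & f & r0 & Cf & pf & Hg & inj & E).
exists m, r, f; repeat (split; [assumption|]); split; [|split; [exact inj|]].
- intros Q U; exact (oval_in_curve g x y dx dy T PC Q U).
- intros n A Hn HA; rewrite <- E; exact (max_area_le_sector g x y dx dy T PC n A Hn HA).
Qed.

(** * Reparametrization and first variation *)

Lemma periodic_bounded (f : R -> R) (U : R) : 0 < U -> (forall t, continuous f t) ->
  (forall t, f (t + U) = f t) -> exists M, forall t, Rabs (f t) <= M.
Proof.
intros HU Cf per.
destruct (continuity_ab_maj (fun t => Rabs (f t)) 0 U) as (z & Hz & _); [lra| |].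
- intros t _; apply continuity_pt_filterlim.
  apply (continuous_Rabs_comp f), Cf.
- exists (Rabs (f z)); intros t.
  destruct (period_shift_in U 0 t HU) as [k Hk].
  rewrite <- (period_Z _ f U k t per); apply Hz; lra.
Qed.

Lemma increasing_of_derive (f df : R -> R) :
  (forall t, is_derive f t (df t)) -> (forall t, 0 < df t) -> forall s t, s < t -> f s < f t.
Proof.
intros D P s t L.
destruct (MVT_cor2 f df s t L) as (z & E & _).
- intros z _; apply is_derive_Reals, D.
- pose proof (P z); nra.
Qed.

Lemma is_derive_inverse (p q rho : R -> R) : (forall t, 0 < rho t) ->
  (forall t, continuous rho t) -> (forall t, is_derive p t (/ rho t)) ->
  (forall z, continuous q z) -> (forall z, p (q z) = z) ->
  forall z, is_derive q z (rho (q z)).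
Proof.
intros Pr Cr Dp Cq pq z.
apply is_derive_Reals; intros e He.
destruct (Cr (q z) (fun w => Rabs (w - rho (q z)) < e)) as [d1 H1].
{ exists (mkposreal e He); intros w Hw; exact Hw. }
destruct (Cq z (fun w => Rabs (w - q z) < d1)) as [d2 H2].
{ exists d1; intros w Hw; exact Hw. }
exists d2; intros h h0 Hh.
specialize (H2 (z + h)).
assert (B : Rabs (q (z + h) - q z) < d1).
{ apply H2; change (Rabs (z + h - z) < d2); now replace (z + h - z) with h by ring. }
destruct (MVT_gen p (q z) (q (z + h)) (fun t => / rho t)) as (c & Hc & E).
- intros; apply Dp.
- intros t _; apply continuity_pt_filterlim, (ex_derive_continuous p); eexists; apply Dp.
- rewrite !pq in E.
  pose proof (Pr c) as Pc.
  replace (q (z + h) - q z) with (rho c * h)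
    by (replace h with (/ rho c * (q (z + h) - q z)) at 1 by lra; field; lra).
  replace (rho c * h / h) with (rho c) by (field; exact h0).
  apply H1; change (Rabs (c - q z) < d1).
  revert B; unfold Rabs; destruct (Rcase_abs (c - q z)), (Rcase_abs (q (z + h) - q z));
    unfold Rmin, Rmax in Hc; destruct (Rle_dec (q z) (q (z + h))); lra.
Qed.

(** Separation of variables: the time to reach the angle [v] is the integral [p v] of [/ rho], and
    [q] is its inverse. One turn takes the time [p (2 * PI)], which is therefore the period of the
    motion. *)
Lemma circle_flow (rho : R -> R) : (forall t, 0 < rho t) -> (forall t, continuous rho t) ->
  (forall t, rho (t + 2 * PI) = rho t) ->
  exists q : R -> R, 0 < RInt (fun t => / rho t) 0 (2 * PI) /\
    (forall u, is_derive q u (rho (q u))) /\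
    (forall u, q (u + RInt (fun t => / rho t) 0 (2 * PI)) = q u + 2 * PI) /\
    q 0 = 0.
Proof.
intros Pr Cr per.
pose proof PI_RGT_0 as pi0.
assert (Ci : forall t, continuous (fun t => / rho t) t).
{ intros t; apply (continuous_Rinv_comp rho); [apply Cr|apply Rgt_not_eq, Pr]. }
destruct (periodic_bounded rho (2 * PI)) as [M HM]; [lra|exact Cr|exact per|].
assert (M0 : 0 < M).
{ apply Rlt_le_trans with (rho 0); [apply Pr|]; apply Rle_trans with (2 := HM 0), Rle_abs. }
assert (Mi : forall t, / M <= / rho t).
{ intros t; apply Rinv_le_contravar; [apply Pr|]; apply Rle_trans with (2 := HM t), Rle_abs. }
set (p := fun v => RInt (fun t => / rho t) 0 v).
assert (Dp : forall t, is_derive p t (/ rho t)).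
{ intros t; exact (is_derive_RInt_cont _ 0 t Ci). }
assert (p0 : p 0 = 0).
{ unfold p; apply (RInt_point (V := R_CompleteNormedModule)). }
assert (inc : forall s t, s < t -> p s < p t).
{ apply increasing_of_derive with (fun t => / rho t); [exact Dp|].
  intros t; apply Rinv_0_lt_compat, Pr. }
assert (grow : forall s t, s <= t -> (t - s) * / M <= p t - p s).
{ intros s t L; unfold p; rewrite <- (RInt_split (fun t => / rho t) 0 s t Ci).
  replace ((t - s) * / M) with (RInt (fun _ => / M) s t) by (rewrite RInt_cst; reflexivity).
  enough (RInt (fun _ => / M) s t <= RInt (fun t => / rho t) s t) by (unfold p; lra).
  apply RInt_le_cont; auto; intros; cont. }
destruct (increasing_inverse p) as (q & Cq & pq & qp).
- exact (continuous_of_derive _ _ Dp).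
- exact inc.
- intros z; exists (- (M * Rabs z)), (M * Rabs z).
  pose proof (Rabs_pos z) as Z; assert (0 <= M * Rabs z) by nra.
  pose proof (grow (- (M * Rabs z)) 0 ltac:(lra)) as G1.
  pose proof (grow 0 (M * Rabs z) ltac:(lra)) as G2.
  replace ((0 - - (M * Rabs z)) * / M) with (Rabs z) in G1 by (field; lra).
  replace ((M * Rabs z - 0) * / M) with (Rabs z) in G2 by (field; lra).
  pose proof (Rle_abs z); pose proof (Rle_abs (- z)) as Z2; rewrite Rabs_Ropp in Z2; lra.
- exists q; split; [|split; [|split]].
  + change (0 < p (2 * PI)); rewrite <- p0; apply inc; lra.
  + exact (is_derive_inverse p q rho Pr Cr Dp Cq pq).
  + intros u; rewrite <- (qp (q u + 2 * PI)); f_equal.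
    rewrite <- (pq u) at 1; unfold p.
    rewrite <- (RInt_split (fun t => / rho t) 0 (q u) (q u + 2 * PI) Ci); f_equal.
    rewrite <- (RInt_periodic (fun t => / rho t) (2 * PI) (q u)), (RInt_shift (fun t => / rho t)) by
      (intros; first [apply Ci | now rewrite per]).
    f_equal; ring.
  + rewrite <- p0 at 1; apply qp.
Qed.

(** A small [e = - t * p] makes the linear term win; [t] is chosen so that [|t * p| <= / 2] and
    [t * s < 1]. *)
Lemma zero_of_quadratic (p s : R) : (forall e, Rabs e <= / 2 -> 0 <= e * p + e * e * s) -> p = 0.
Proof.
intros H; destruct (Req_dec p 0) as [E|N]; [exact E|exfalso].
pose proof (Rabs_pos p) as P; pose proof (Rabs_pos s) as Q.
set (t := / (2 * (1 + Rabs p + Rabs s))).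
assert (t0 : 0 < t) by (apply Rinv_0_lt_compat; lra).
assert (tE : t * (2 * (1 + Rabs p + Rabs s)) = 1) by (apply Rinv_l; lra).
specialize (H (- t * p)).
assert (B : Rabs (- t * p) <= / 2).
{ rewrite Rabs_mult, Rabs_Ropp, (Rabs_pos_eq t) by lra; nra. }
specialize (H B).
assert (p2 : 0 < p * p) by nra.
assert (E : - t * p * p + - t * p * (- t * p) * s = (p * p) * (t * (t * s - 1))) by ring.
rewrite E in H.
assert (t * s < 1) by (pose proof (Rle_abs s); nra).
assert (0 < (p * p) * (t * (1 - t * s))) by (apply Rmult_lt_0_compat; [|apply Rmult_lt_0_compat]; lra).
lra.
Qed.

Lemma RInt_cos_harmonic (k : nat) (al : R) : (1 <= k)%nat ->
  RInt (fun v => cos (INR k * v + al)) 0 (2 * PI) = 0.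
Proof.
intros Hk; assert (k0 : 0 < INR k) by (apply lt_0_INR; lia).
rewrite (RInt_of_derive (fun v => / INR k * sin (INR k * v + al))).
- replace (INR k * (2 * PI) + al) with (al + 2 * INR k * PI) by ring.
  rewrite sin_period; replace (INR k * 0 + al) with al by ring; eqR; ring.
- intros t; evar_last; [deriv|cbv beta; field; lra].
- intros t; cont.
Qed.

Section Reparametrization.
Variables (g : point -> Prop) (m r : R) (f : R -> R).
Hypothesis r0 : 0 < r.
Hypothesis Cf : forall t, continuous f t.
Hypothesis pf : forall t, f (t + 2 * PI) = f t.
Hypothesis Hg : forall p, g p <-> exists t, (m + r * cos t, f t) = p.
Hypothesis ov : forall Q U, 0 < U -> (forall t, continuous (fun s => fst (Q s)) t) ->
  (forall t, continuous (fun s => snd (Q s)) t) ->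
  (forall t, Q (t + U) = Q t) -> (forall t, g (Q t)) ->
  (forall s t, s < t -> t < s + U -> Q s <> Q t) -> oval Q U.
Hypothesis inj : forall s t, s < t -> t < s + 2 * PI -> (m + r * cos s, f s) <> (m + r * cos t, f t).

(* With [q' = rho (q)], the third derivative of [cos (q u)] in [u] is
   [rho (v) * D (v)] at [v = q u], where [D v] is the function integrated below. *)
Lemma reparametrized_lower_bound (rho rho1 rho2 rho3 : R -> R) :
  (forall t, 0 < rho t) -> (forall t, rho (t + 2 * PI) = rho t) ->
  (forall t, rho1 (t + 2 * PI) = rho1 t) -> (forall t, rho2 (t + 2 * PI) = rho2 t) ->
  (forall t, rho3 (t + 2 * PI) = rho3 t) ->
  (forall t, is_derive rho t (rho1 t)) -> (forall t, is_derive rho1 t (rho2 t)) ->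
  (forall t, is_derive rho2 t (rho3 t)) -> (forall t, continuous rho3 t) ->
  exists C, forall n A, (3 <= n)%nat -> is_max_inscribed_area g n A ->
    r * RInt (fun t => f t * sin t) 0 (2 * PI)
      - RInt (fun t => / rho t) 0 (2 * PI) ^ 2 / 6 *
        (r * RInt (fun v => f v * ((rho v * rho v - rho1 v * rho1 v - rho v * rho2 v) * sin v
                               - 3 * (rho v * rho1 v) * cos v)) 0 (2 * PI)) / INR n ^ 2
      - C / INR n ^ 3 <= A.
Proof.
intros Pr per per1 per2 per3 D1 D2 D3 C3.
pose proof (continuous_of_derive _ _ D1) as C0.
pose proof (continuous_of_derive _ _ D2) as C1.
pose proof (continuous_of_derive _ _ D3) as C2.
pose proof PI_RGT_0 as pi0.
destruct (circle_flow rho Pr C0 per) as (q & U0 & Dq & pq & q0).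
set (U := RInt (fun t => / rho t) 0 (2 * PI)) in *.
pose proof (continuous_of_derive _ _ Dq) as Cq.
pose proof (increasing_of_derive q (fun u => rho (q u)) Dq (fun u => Pr (q u))) as inc.
set (Q := fun u => (m + r * cos (q u), f (q u))).
assert (pc : forall t, cos (t + 2 * PI) = cos t) by (intros; rewrite cos_plus, cos_2PI, sin_2PI; ring).
assert (ps : forall t, sin (t + 2 * PI) = sin t) by (intros; rewrite sin_plus, cos_2PI, sin_2PI; ring).
assert (OQ : oval Q U).
{ apply ov; unfold Q; cbn [fst snd]; [exact U0|intros; cont|intros; cont| | |].
  - intros t; now rewrite pq, pc, pf.
  - intros t; apply Hg; now exists (q t).
  - intros s t L1 L2; apply inj; [now apply inc|rewrite <- pq; now apply inc]. }
set (G2 := fun v => (rho v * rho v - rho1 v * rho1 v - rho v * rho2 v) * sin v - 3 * (rho v * rho1 v) * cos v).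
set (G2' := fun v => (2 * rho v * rho1 v - 2 * rho1 v * rho2 v - rho1 v * rho2 v - rho v * rho3 v) * sin v
   + (rho v * rho v - rho1 v * rho1 v - rho v * rho2 v) * cos v
   - 3 * (rho1 v * rho1 v + rho v * rho2 v) * cos v + 3 * (rho v * rho1 v) * sin v).
set (G3 := fun v => rho v * (rho1 v * G2 v + rho v * G2' v)).
assert (DG2 : forall v, is_derive G2 v (G2' v)).
{ intros v; unfold G2, G2'; evar_last; [deriv|cbv beta; ring]. }
destruct (periodic_bounded (fun v => r * G3 v) (2 * PI)) as [M HM].
{ lra. }
{ intros t; unfold G3, G2, G2'; cont. }
{ intros t; unfold G3, G2, G2'; now rewrite per, per1, per2, per3, pc, ps. }
destruct (periodic_bounded f (2 * PI)) as [N HN]; [lra|exact Cf|exact pf|].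
destruct (max_area_lower_expansion g Q U M N
  (fun u => r * (- rho (q u) * sin (q u)))
  (fun u => r * (- (rho (q u) * rho1 (q u) * sin (q u) + rho (q u) * rho (q u) * cos (q u))))
  (fun u => r * (rho (q u) * G2 (q u)))
  (fun u => r * G3 (q u))) as [C HC].
- exact OQ.
- intros t; apply Hg; now exists (q t).
- intros t; unfold Q; cbn [fst]; evar_last; [deriv|cbv beta; ring].
- intros t; evar_last; [deriv|cbv beta; ring].
- intros t; unfold G2; evar_last; [deriv|cbv beta; ring].
- intros t; evar_last; [deriv|unfold G3; cbv beta; ring].
- intros t; apply HM.
- intros t; unfold Q; cbn [snd]; apply HN.
- exists C; intros n A Hn HA.
  specialize (HC n A Hn HA); unfold Q in HC; cbn [snd] in HC.
  assert (qU : q U = 2 * PI) by (rewrite <- (Rplus_0_l U), pq, q0; ring).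
  assert (CG2 : forall t, continuous G2 t) by exact (continuous_of_derive _ _ DG2).
  (* The factor [rho (q u)] is the Jacobian of [v = q u], so the integrals return to the angle. *)
  assert (sub : forall F : R -> R, (forall t, continuous F t) ->
     RInt (fun u => rho (q u) * F (q u)) 0 U = RInt F 0 (2 * PI)).
  { intros F CF; replace (RInt F 0 (2 * PI)) with (RInt F (q 0) (q U)) by now rewrite q0, qU.
    apply (RInt_comp_cont F q (fun u => rho (q u))); [exact CF|exact Dq|intros; cont]. }
  rewrite (RInt_ext (fun u => f (q u) * (r * (- rho (q u) * sin (q u))))
    (fun u => rho (q u) * (- r * (f (q u) * sin (q u))))) in HC by (intros; eqR; ring).
  rewrite (sub (fun v => - r * (f v * sin v))) in HC by (intros; cont).
  rewrite (RInt_ext (fun u => f (q u) * (r * (rho (q u) * G2 (q u))))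
    (fun u => rho (q u) * (r * (f (q u) * G2 (q u))))) in HC by (intros; eqR; ring).
  rewrite (sub (fun v => r * (f v * G2 v))) in HC by (intros; cont).
  rewrite !RInt_mul in HC by (intros; cont).
  unfold G2 in HC; lra.
Qed.

Variables (A a : nat -> R).
Hypothesis HA : forall n, (3 <= n)%nat -> is_max_inscribed_area g n (A n).
Hypothesis Ha : even_asymptotic_expansion A a.
Hypothesis upper : forall n B, (3 <= n)%nat -> is_max_inscribed_area g n B ->
  B <= r * RInt (fun t => f t * sin t) 0 (2 * PI).

Lemma expansion_lower_bound (S K C : R) : (forall n, (3 <= n)%nat -> A n <= S) ->
  (forall n B, (3 <= n)%nat -> is_max_inscribed_area g n B ->
     S - K / INR n ^ 2 - C / INR n ^ 3 <= B) ->
  a 0%nat = S /\ - K <= a 1%nat.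
Proof.
intros U L; destruct (expansion_limits A a Ha) as [L0 L1].
assert (E0 : a 0%nat = S).
{ apply Rle_antisym.
  - apply (is_lim_seq_le_loc A (fun _ => S) (a 0%nat) S); [|exact L0|apply is_lim_seq_const].
    exists 3%nat; exact U.
  - apply (is_lim_seq_le_loc (fun n => S - K / INR n ^ 2 - C / INR n ^ 3) A S (a 0%nat)); [| |exact L0].
    + exists 3%nat; intros n Hn; now apply L, HA.
    + replace (Finite S) with (Finite (S - 0 - 0)) by (f_equal; ring).
      apply is_lim_seq_minus'; [apply is_lim_seq_minus'|].
      * apply is_lim_seq_const.
      * apply is_lim_seq_div_pow.
      * apply is_lim_seq_div_pow. }
split; [exact E0|].
apply (is_lim_seq_le_loc (fun n => - K - C / INR n ^ 1) (fun n => INR n ^ 2 * (A n - a 0%nat)) (- K) (a 1%nat)); [| |exact L1].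
- exists 3%nat; intros n Hn; specialize (L n (A n) Hn (HA n Hn)).
  assert (0 < INR n) by (apply lt_0_INR; lia).
  rewrite E0; apply Rle_trans with (INR n ^ 2 * (S - K / INR n ^ 2 - C / INR n ^ 3 - S)).
  + apply Req_le; field; lra.
  + apply Rmult_le_compat_l; [apply pow_le; lra|lra].
- replace (Finite (- K)) with (Finite (- K - 0)) by (f_equal; ring).
  apply is_lim_seq_minus'; [apply is_lim_seq_const|apply is_lim_seq_div_pow].
Qed.

Lemma reparametrized_coefficients (rho rho1 rho2 rho3 : R -> R) :
  (forall t, 0 < rho t) -> (forall t, rho (t + 2 * PI) = rho t) ->
  (forall t, rho1 (t + 2 * PI) = rho1 t) -> (forall t, rho2 (t + 2 * PI) = rho2 t) ->
  (forall t, rho3 (t + 2 * PI) = rho3 t) ->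
  (forall t, is_derive rho t (rho1 t)) -> (forall t, is_derive rho1 t (rho2 t)) ->
  (forall t, is_derive rho2 t (rho3 t)) -> (forall t, continuous rho3 t) ->
  a 0%nat = r * RInt (fun t => f t * sin t) 0 (2 * PI) /\
  - (RInt (fun t => / rho t) 0 (2 * PI) ^ 2 / 6 *
     (r * RInt (fun v => f v * ((rho v * rho v - rho1 v * rho1 v - rho v * rho2 v) * sin v
                               - 3 * (rho v * rho1 v) * cos v)) 0 (2 * PI))) <= a 1%nat.
Proof.
intros P0 P1 P2 P3 P4 D1 D2 D3 C3.
destruct (reparametrized_lower_bound rho rho1 rho2 rho3 P0 P1 P2 P3 P4 D1 D2 D3 C3) as [C HC].
apply (expansion_lower_bound _ _ C); [|exact HC].
intros n Hn; apply (upper n); auto.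
Qed.

(** For [rho = 1] the period is [2 * PI] and [D] is the sine, so the second-order term is
    [(2 * PI) ^ 2 / 6] times the area. *)
Lemma sas_inequality :
  a 0%nat = r * RInt (fun t => f t * sin t) 0 (2 * PI) /\ - 3 * a 1%nat <= 2 * PI ^ 2 * a 0%nat.
Proof.
destruct (reparametrized_coefficients (fun _ => 1) (fun _ => 0) (fun _ => 0) (fun _ => 0)) as [E L];
  try (intros; lra); try (intros; apply is_derive_Rconst); try (intros; apply continuous_const).
split; [exact E|].
rewrite (RInt_ext (fun v => f v * ((1 * 1 - 0 * 0 - 1 * 0) * sin v - 3 * (1 * 0) * cos v))
  (fun v => f v * sin v)) in L by (intros; eqR; ring).
rewrite <- E, RInt_cst, Rinv_1 in L; lra.
Qed.

Hypothesis equality : - 3 * a 1%nat = 2 * PI ^ 2 * a 0%nat.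

(* With [rho = 1 + e cos (k v + al)] the period [RInt (/ rho)] is [2 PI + O(e^2)], so the
   minimality of [rho = 1] kills the coefficient of [e] in [RInt (f D)]. *)
Lemma first_variation (k : nat) (al : R) : (1 <= k)%nat ->
  RInt (fun v => f v * ((2 + INR k ^ 2) * cos (INR k * v + al) * sin v
                        + 3 * INR k * sin (INR k * v + al) * cos v)) 0 (2 * PI) = 0.
Proof.
intros Hk; assert (k0 : 0 < INR k) by (apply lt_0_INR; lia).
pose proof PI_RGT_0 as pi0.
set (K0 := RInt (fun t => f t * sin t) 0 (2 * PI)).
set (K1 := RInt _ 0 (2 * PI)).
set (c := fun v => cos (INR k * v + al)); set (s := fun v => sin (INR k * v + al)).
assert (pcs : forall t, c (t + 2 * PI) = c t /\ s (t + 2 * PI) = s t).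
{ intros t; unfold c, s.
  replace (INR k * (t + 2 * PI) + al) with (INR k * t + al + 2 * INR k * PI) by ring.
  now rewrite cos_period, sin_period. }
assert (pc : forall t, c (t + 2 * PI) = c t) by (intros; apply pcs).
assert (ps : forall t, s (t + 2 * PI) = s t) by (intros; apply pcs).
assert (Dc : forall t, is_derive c t (- INR k * s t)).
{ intros t; unfold c, s; evar_last; [deriv|cbv beta; ring]. }
assert (Ds : forall t, is_derive s t (INR k * c t)).
{ intros t; unfold c, s; evar_last; [deriv|cbv beta; ring]. }
pose proof (continuous_of_derive _ _ Dc) as Cc.
pose proof (continuous_of_derive _ _ Ds) as Cs.
set (K2 := RInt (fun v => f v * ((c v * c v - INR k ^ 2 * (s v * s v) + INR k ^ 2 * (c v * c v)) * sin v
                        + 3 * INR k * (s v * c v) * cos v)) 0 (2 * PI)).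
set (B := Rabs K0 + Rabs K1 + Rabs K2).
(* [K2] is the coefficient of [e ^ 2] in the integral; [5 * B] absorbs the second-order change of
   the squared period. *)
apply zero_of_quadratic with (K2 + 5 * B); intros e He.
apply Rabs_le_between in He.
assert (cb : forall v, -1 <= c v <= 1) by (intros; apply COS_bound).
assert (rho0 : forall v, / 2 <= 1 + e * c v) by (intros v; specialize (cb v); nra).
destruct (reparametrized_coefficients (fun v => 1 + e * c v) (fun v => - (e * INR k) * s v)
   (fun v => - (e * INR k ^ 2) * c v) (fun v => e * INR k ^ 3 * s v)) as [E L].
{ intros t; specialize (rho0 t); lra. }
{ intros t; now rewrite pc. }
{ intros t; now rewrite ps. }
{ intros t; now rewrite pc. }
{ intros t; now rewrite ps. }
{ intros t; evar_last; [deriv|cbv beta; ring]. }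
{ intros t; evar_last; [deriv|cbv beta; ring]. }
{ intros t; evar_last; [deriv|cbv beta; ring]. }
{ intros t; cont. }
set (U := RInt (fun t => / (1 + e * c t)) 0 (2 * PI)) in L.
rewrite (RInt_ext _ (fun v => f v * sin v + (e * (f v * ((2 + INR k ^ 2) * c v * sin v + 3 * INR k * s v * cos v))
   + e * e * (f v * ((c v * c v - INR k ^ 2 * (s v * s v) + INR k ^ 2 * (c v * c v)) * sin v
                        + 3 * INR k * (s v * c v) * cos v))))) in L by (intros; eqR; ring).
rewrite !RInt_add, !RInt_mul in L by (intros; cont).
change (- (U ^ 2 / 6 * (r * (K0 + (e * K1 + e * e * K2)))) <= a 1%nat) in L.
change (a 0%nat = r * K0) in E.
assert (U1 : 0 <= U).
{ replace 0 with (RInt (fun _ => 0) 0 (2 * PI)) by (rewrite RInt_cst; eqR; ring).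
  apply RInt_le_cont; [lra|intros; cont| |].
  - intros t; apply (continuous_Rinv_comp (fun t => 1 + e * c t)); [cont|specialize (rho0 t); lra].
  - intros t; apply Rlt_le, Rinv_0_lt_compat; specialize (rho0 t); lra. }
(* For [|z| <= |e| <= / 2] one has [/ (1 + z) <= 1 - z + 2 * (e * e)], and the linear term
   integrates to 0. *)
assert (U2 : U <= 2 * PI * (1 + 2 * (e * e))).
{ replace (2 * PI * (1 + 2 * (e * e))) with (RInt (fun t => 1 + 2 * (e * e) - e * c t) 0 (2 * PI)).
  - apply RInt_le_cont; [lra| |intros; cont|].
    + intros t; apply (continuous_Rinv_comp (fun t => 1 + e * c t)); [cont|specialize (rho0 t); lra].
    + intros t; pose proof (rho0 t) as R0; pose proof (cb t).
      apply Rmult_le_reg_l with (1 + e * c t); [lra|].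
      rewrite Rinv_r by lra.
      set (z := e * c t) in *.
      assert (z2 : z * z <= e * e).
      { unfold z; assert (c t * c t <= 1) by nra; assert (0 <= e * e) by nra; nra. }
      assert (0 <= (1 + z) * (e * e - z * z)) by (apply Rmult_le_pos; lra).
      assert (0 <= z * z * (1 + 2 * z)) by (apply Rmult_le_pos; nra).
      nra.
  - rewrite RInt_sub, RInt_mul, RInt_cst by (intros; cont).
    unfold c; rewrite RInt_cos_harmonic by exact Hk; eqR; ring. }
set (K := K0 + (e * K1 + e * e * K2)) in *.
assert (a0p : 0 <= a 0%nat).
{ rewrite E; apply Rle_trans with (A 3); [|apply (upper 3); [lia|apply HA; lia]].
  destruct (HA 3 ltac:(lia)) as [(v & _ & _ & <-) _].
  unfold polygon_area; apply Rdiv_le_0_compat; [apply Rabs_pos|lra]. }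
assert (L1 : 4 * PI ^ 2 * K0 <= U ^ 2 * K).
{ apply Rmult_le_reg_l with r; [exact r0|].
  replace (r * (4 * PI ^ 2 * K0)) with (4 * PI ^ 2 * a 0%nat) by (rewrite E; ring). lra. }
assert (K0p : 0 <= K0) by (rewrite E in a0p; nra).
assert (pi2 : 0 < PI ^ 2) by (apply pow_lt; lra).
(* The upper bound on [U] may only be inserted for nonnegative [K]. A negative [K] would force
   [U = 0], although [1 + e * c t <= 2] gives [PI <= U]. *)
assert (Kp : 0 <= K).
{ apply Rnot_lt_le; intros Kn.
  assert (U ^ 2 * K <= 0) by nra.
  assert (0 <= 4 * PI ^ 2 * K0) by nra.
  assert (K00 : K0 = 0) by nra.
  assert (UU : U ^ 2 = 0) by nra.
  assert (U0 : U = 0) by nra.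
  assert (0 < U); [|lra].
  apply Rlt_le_trans with (RInt (fun _ => / 2) 0 (2 * PI)).
  - rewrite RInt_cst; lra.
  - apply RInt_le_cont; [lra|intros; cont| |].
    + intros t; apply (continuous_Rinv_comp (fun t => 1 + e * c t)); [cont|specialize (rho0 t); lra].
    + intros t; pose proof (rho0 t); pose proof (cb t).
      apply Rinv_le_contravar; [lra|nra]. }
assert (e2 : e * e <= / 4) by nra.
assert (e2p : 0 <= e * e) by nra.
(* [(1 + 2 * (e * e)) ^ 2 <= 1 + 5 * (e * e)] because [e * e <= / 4]. *)
assert (L2 : K0 <= (1 + 5 * (e * e)) * K).
{ apply Rmult_le_reg_l with (4 * PI ^ 2); [lra|].
  apply Rle_trans with (1 := L1).
  rewrite <- Rmult_assoc; apply Rmult_le_compat_r; [exact Kp|].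
  apply Rle_trans with ((2 * PI * (1 + 2 * (e * e))) ^ 2); [apply pow_incr; lra|].
  replace ((2 * PI * (1 + 2 * (e * e))) ^ 2) with (4 * PI ^ 2 * (1 + 4 * (e * e) + 4 * (e * e) * (e * e))) by ring.
  apply Rmult_le_compat_l; [lra|nra]. }
assert (KB : K <= B).
{ unfold K, B.
  pose proof (Rle_abs K0); pose proof (Rle_abs K2); pose proof (Rabs_pos K2).
  assert (e * K1 <= Rabs K1).
  { pose proof (Rle_abs K1); pose proof (Rle_abs (- K1)) as Q; rewrite Rabs_Ropp in Q.
    pose proof (Rabs_pos K1). destruct (Rle_dec 0 e); nra. }
  assert (e * e * K2 <= Rabs K2) by nra. lra. }
assert (5 * (e * e) * K <= 5 * (e * e) * B) by (apply Rmult_le_compat_l; lra).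
unfold K in L2 at 1; unfold K in *; lra.
Qed.

(** The product formulas turn the first variation at frequency [j + 1] into a recurrence between the
    frequencies [j] and [j + 2]. Its right-hand side has the factor [j * (j - 1)], which vanishes
    for [j = 0] and [j = 1]; this starts the induction at the frequencies 2 and 3. *)
Lemma sine_coefficient_zero (k : nat) : (2 <= k)%nat -> forall al,
  RInt (fun v => f v * sin (INR k * v + al)) 0 (2 * PI) = 0.
Proof.
set (B := fun k al => RInt (fun v => f v * sin (INR k * v + al)) 0 (2 * PI)).
assert (rec : forall k al, (INR k + 2) * (INR k + 3) * B (S (S k)) al = INR k * (INR k - 1) * B k al).
{ intros j al; pose proof (first_variation (S j) al ltac:(lia)) as V.
  enough (E : RInt (fun v => f v * ((2 + INR (S j) ^ 2) * cos (INR (S j) * v + al) * sin v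
                        + 3 * INR (S j) * sin (INR (S j) * v + al) * cos v)) 0 (2 * PI) =
      (INR j + 2) * (INR j + 3) / 2 * B (S (S j)) al - INR j * (INR j - 1) / 2 * B j al) by (rewrite E in V; lra).
  unfold B; rewrite <- !RInt_mul, <- RInt_sub by (intros; cont).
  apply RInt_ext; intros v _; eqR.
  rewrite !S_INR.
  replace ((INR j + 1 + 1) * v + al) with (((INR j + 1) * v + al) + v) by ring.
  replace (INR j * v + al) with (((INR j + 1) * v + al) - v) by ring.
  generalize ((INR j + 1) * v + al) as w; intros w.
  rewrite sin_plus, sin_minus; field. }
assert (two : forall j al, B (S (S j)) al = 0 /\ B (S (S (S j))) al = 0).
{ induction j as [|j IH]; intros al.
  - pose proof (rec 0%nat al) as R0; pose proof (rec 1%nat al) as R1.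
    simpl INR in R0, R1; split; lra.
  - destruct (IH al) as [I1 I2]; split; [exact I2|].
    pose proof (rec (S (S j)) al) as R0; rewrite I1 in R0.
    assert (0 < INR (S (S j))) by (apply lt_0_INR; lia).
    apply Rmult_eq_reg_l with ((INR (S (S j)) + 2) * (INR (S (S j)) + 3)); [lra|].
    apply Rgt_not_eq, Rmult_lt_0_compat; lra. }
intros Hk al; destruct k as [|[|k]]; try lia; exact (proj1 (two k al)).
Qed.

End Reparametrization.

(** * Fourier uniqueness *)

Lemma continuous_Rpow (f : R -> R) (n : nat) (t : R) :
  continuous f t -> continuous (fun s => f s ^ n) t.
Proof.
intros C; induction n as [|n IH]; simpl; [apply continuous_const|].
now apply (continuous_Rmult f (fun s => f s ^ n)).
Qed.

Section FourierUniqueness.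
Variable f : R -> R.
Hypothesis Cf : forall t, continuous f t.
Hypothesis pf : forall t, f (t + 2 * PI) = f t.
Hypothesis orth : forall (k : nat) (al : R),
  RInt (fun v => f v * cos (INR k * v + al)) 0 (2 * PI) = 0.

(** Multiplying a harmonic by [1 + cos (v - v0)] gives a combination of it and its two neighbours,
    so induction on [N] works with all frequencies and phases at once. *)
Lemma kernel_orthogonal (v0 : R) (N : nat) : forall (k : nat) (al : R),
  RInt (fun v => f v * (1 + cos (v - v0)) ^ N * cos (INR k * v + al)) 0 (2 * PI) = 0.
Proof.
induction N as [|N IH]; intros k al.
- rewrite (RInt_ext _ (fun v => f v * cos (INR k * v + al))) by (intros; simpl; eqR; ring).
  apply orth.
- assert (Cw : forall t, continuous (fun v => (1 + cos (v - v0)) ^ N) t).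
  { intros t; apply (continuous_Rpow (fun v => 1 + cos (v - v0))); cont. }
  (* For [k = 0] the frequency -1 is the frequency 1 with the opposite phase. *)
  assert (low : RInt (fun v => f v * (1 + cos (v - v0)) ^ N * cos ((INR k - 1) * v + (al + v0))) 0 (2 * PI) = 0).
  { destruct k as [|k].
    - rewrite (RInt_ext _ (fun v => f v * (1 + cos (v - v0)) ^ N * cos (INR 1 * v + (- al - v0)))); [apply IH|].
      intros v _; f_equal; rewrite <- cos_neg; f_equal; simpl; ring.
    - apply (eq_trans (y := RInt (fun v => f v * (1 + cos (v - v0)) ^ N * cos (INR k * v + (al + v0))) 0 (2 * PI)));
        [|apply IH].
      apply RInt_ext; intros v _; do 3 f_equal.
      rewrite S_INR; ring. }
  rewrite (RInt_ext _ (fun v => f v * (1 + cos (v - v0)) ^ N * cos (INR k * v + al) +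
    / 2 * (f v * (1 + cos (v - v0)) ^ N * cos (INR (S k) * v + (al - v0)) +
           f v * (1 + cos (v - v0)) ^ N * cos ((INR k - 1) * v + (al + v0))))).
  + rewrite RInt_add, RInt_mul, RInt_add, !IH, low by (intros; cont); eqR; ring.
  + intros v _; eqR.
    rewrite S_INR.
    replace ((INR k + 1) * v + (al - v0)) with ((INR k * v + al) + (v - v0)) by ring.
    replace ((INR k - 1) * v + (al + v0)) with ((INR k * v + al) - (v - v0)) by ring.
    generalize (INR k * v + al) (v - v0); intros z1 z2.
    rewrite cos_plus, cos_minus; simpl; field.
Qed.

(* As [N] grows, [(1 + cos (v - v0)) ^ N] concentrates at [v0]. *)
Lemma orthogonal_nonpos (v0 : R) : f v0 <= 0.
Proof.
apply Rnot_lt_le; intros P.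
pose proof PI_RGT_0 as pi0.
set (p := f v0) in *.
destruct (positive_near (fun v => f v - p / 2) v0) as (d1 & D1 & near).
{ cont. }
{ fold p; lra. }
destruct (periodic_bounded f (2 * PI)) as [M HM]; [lra|exact Cf|exact pf|].
set (d := Rmin d1 (PI / 2)).
assert (d0 : 0 < d) by (apply Rmin_pos; lra).
assert (dp : d <= PI / 2) by apply Rmin_r.
assert (dd : d <= d1) by apply Rmin_l.
set (a1 := 1 + cos (d / 2)); set (b1 := 1 + cos d).
assert (ab : b1 < a1).
{ unfold a1, b1; apply Rplus_lt_compat_l, cos_decreasing_1; lra. }
assert (b0 : 0 < b1).
{ unfold b1; pose proof (cos_ge_0 d); lra. }
assert (M0 : p <= M) by (apply Rle_trans with (2 := HM v0), Rle_abs).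
(* Within distance [d] of [v0], [f] exceeds [p / 2]; farther away the kernel is at most [b1 ^ N];
   within [d / 2] it is at least [a1 ^ N]. The vanishing integral balances these contributions. *)
assert (key : forall N, p / 2 * (d * a1 ^ N) <= 2 * PI * ((M + p / 2) * b1 ^ N)).
{ intros N.
  set (w := fun v => (1 + cos (v - v0)) ^ N).
  assert (Cw : forall t, continuous w t).
  { intros t; apply (continuous_Rpow (fun v => 1 + cos (v - v0))); cont. }
  assert (w0 : forall v, 0 <= w v).
  { intros v; apply pow_le; pose proof (COS_bound (v - v0)); lra. }
  assert (pw : forall t, f (t + 2 * PI) * w (t + 2 * PI) = f t * w t).
  { intros t; unfold w; rewrite pf.
    replace (t + 2 * PI - v0) with (t - v0 + 2 * PI) by ring.
    now rewrite cos_plus, cos_2PI, sin_2PI, Rmult_1_r, Rmult_0_r, Rminus_0_r. }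
  assert (Z : RInt (fun v => f v * w v) (v0 - PI) (v0 + PI) = 0).
  { replace (v0 - PI) with (0 + (v0 - PI)) by ring.
    replace (v0 + PI) with (2 * PI + (v0 - PI)) by ring.
    rewrite <- (RInt_shift (fun v => f v * w v)) by (intros; cont).
    rewrite (RInt_periodic (fun v => f v * w v)) by (intros; first [solve [cont] | apply pw]).
    refine (eq_trans _ (kernel_orthogonal v0 N 0 0)); apply RInt_ext; intros v _.
    unfold w; simpl INR; rewrite Rmult_0_l, Rplus_0_l, cos_0; eqR; ring. }
  assert (L : RInt (fun v => p / 2 * w v - (M + p / 2) * b1 ^ N) (v0 - PI) (v0 + PI) <= 0).
  { rewrite <- Z; apply RInt_le; [lra|apply ex_RInt_cont; intros; cont|apply ex_RInt_cont; intros; cont|].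
    intros v Hv.
    pose proof (pow_lt b1 N b0) as bN.
    destruct (Rlt_dec (Rabs (v - v0)) d) as [I|I].
    - specialize (near v ltac:(lra)); specialize (w0 v).
      assert (0 <= (f v - p / 2) * w v) by (apply Rmult_le_pos; lra).
      assert (0 <= (M + p / 2) * b1 ^ N) by (apply Rmult_le_pos; lra). lra.
    - assert (C : cos (v - v0) <= cos d).
      { assert (E : cos (v - v0) = cos (Rabs (v - v0))).
        { unfold Rabs; destruct (Rcase_abs (v - v0)); [now rewrite cos_neg|reflexivity]. }
        rewrite E; destruct (Req_dec d (Rabs (v - v0))) as [->|N']; [lra|].
        assert (Rabs (v - v0) <= PI) by (apply Rabs_le; lra).
        apply Rlt_le, cos_decreasing_1; lra. }
      assert (W : w v <= b1 ^ N).
      { apply pow_incr; pose proof (COS_bound (v - v0)); unfold b1; lra. }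
      pose proof (HM v) as B; apply Rabs_le_between in B; specialize (w0 v).
      assert (0 <= (f v + M) * w v) by (apply Rmult_le_pos; lra).
      assert (0 <= (M + p / 2) * (b1 ^ N - w v)) by (apply Rmult_le_pos; lra). lra. }
  rewrite RInt_sub, RInt_mul, RInt_cst in L by (intros; cont).
  assert (W : d * a1 ^ N <= RInt w (v0 - PI) (v0 + PI)).
  { rewrite <- (RInt_split w (v0 - PI) (v0 - d / 2) (v0 + PI) Cw).
    rewrite <- (RInt_split w (v0 - d / 2) (v0 + d / 2) (v0 + PI) Cw).
    assert (ge0 : forall s t, s <= t -> 0 <= RInt w s t).
    { intros s t H; apply RInt_ge_0; [exact H|now apply ex_RInt_cont|auto]. }
    pose proof (ge0 (v0 - PI) (v0 - d / 2) ltac:(lra)).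
    pose proof (ge0 (v0 + d / 2) (v0 + PI) ltac:(lra)).
    assert (RInt (fun _ => a1 ^ N) (v0 - d / 2) (v0 + d / 2) <= RInt w (v0 - d / 2) (v0 + d / 2)).
    { apply RInt_le; [lra|apply ex_RInt_cont; intros; cont|now apply ex_RInt_cont|].
      intros v Hv; apply pow_incr; split.
      - pose proof (COS_bound (d / 2)); unfold a1; lra.
      - unfold a1; apply Rplus_le_compat_l.
        destruct (Rle_dec 0 (v - v0)) as [S|S].
        + destruct (Req_dec (v - v0) (d / 2)) as [->|]; [lra|].
          apply Rlt_le, cos_decreasing_1; lra.
        + rewrite <- (cos_neg (v - v0)).
          apply Rlt_le, cos_decreasing_1; lra. }
    rewrite RInt_cst in *.
    replace (v0 + d / 2 - (v0 - d / 2)) with d in * by field. lra. }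
  assert (p / 2 * (d * a1 ^ N) <= p / 2 * RInt w (v0 - PI) (v0 + PI)) by (apply Rmult_le_compat_l; lra).
  lra. }
set (q := a1 / b1).
assert (q1 : 0 < q - 1).
{ unfold q; replace (a1 / b1 - 1) with ((a1 - b1) / b1) by (field; lra).
  apply Rdiv_lt_0_compat; lra. }
(* Dividing by [b1 ^ N] leaves [q ^ N] with [q > 1], which grows at least linearly by Bernoulli's
   inequality [poly]. *)
assert (key2 : forall N, p / 2 * d * (1 + INR N * (q - 1)) <= 2 * PI * (M + p / 2)).
{ intros N; pose proof (pow_lt b1 N b0) as bN.
  apply Rmult_le_reg_r with (b1 ^ N); [exact bN|].
  apply Rle_trans with (p / 2 * (d * a1 ^ N)); [|specialize (key N); lra].
  replace a1 with (q * b1) by (unfold q; field; lra).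
  rewrite Rpow_mult_distr, <- !Rmult_assoc.
  apply Rmult_le_compat_r; [lra|]; apply Rmult_le_compat_l; [nra|].
  replace q with (1 + (q - 1)) at 2 by ring.
  now apply poly. }
assert (s0 : 0 < p / 2 * d * (q - 1)) by (repeat apply Rmult_lt_0_compat; lra).
destruct (INR_unbounded (2 * PI * (M + p / 2) / (p / 2 * d * (q - 1)))) as [N HN].
apply Rlt_div_l in HN; [|exact s0].
specialize (key2 N); assert (0 < p / 2 * d) by (apply Rmult_lt_0_compat; lra). lra.
Qed.
End FourierUniqueness.

Lemma orthogonal_zero (f : R -> R) : (forall t, continuous f t) ->
  (forall t, f (t + 2 * PI) = f t) ->
  (forall (k : nat) (al : R), RInt (fun v => f v * cos (INR k * v + al)) 0 (2 * PI) = 0) ->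
  forall v, f v = 0.
Proof.
intros Cf pf orth v; apply Rle_antisym.
- now apply orthogonal_nonpos.
- enough (- f v <= 0) by lra.
  apply (orthogonal_nonpos (fun v => - f v)).
  + intros; cont.
  + intros; now rewrite pf.
  + intros k al; rewrite (RInt_ext _ (fun v => -1 * (f v * cos (INR k * v + al)))) by (intros; eqR; ring).
    rewrite RInt_mul, orth by (intros; cont); eqR; ring.
Qed.

(** The witnesses are the Fourier coefficients of orders 0 and 1. The remainder is orthogonal to the
    harmonics of orders 0 and 1 by this choice and to the higher ones by hypothesis. *)
Lemma first_harmonics (f : R -> R) : (forall t, continuous f t) ->
  (forall t, f (t + 2 * PI) = f t) ->
  (forall k, (2 <= k)%nat -> forall al, RInt (fun v => f v * sin (INR k * v + al)) 0 (2 * PI) = 0) ->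
  exists p q s, forall v, f v = p + q * cos v + s * sin v.
Proof.
intros Cf pf H.
pose proof PI_RGT_0 as pi0.
set (p := RInt f 0 (2 * PI) / (2 * PI)).
set (q := RInt (fun v => f v * cos v) 0 (2 * PI) / PI).
set (s := RInt (fun v => f v * sin v) 0 (2 * PI) / PI).
assert (h : forall k al, (1 <= k)%nat -> RInt (fun v => cos (INR k * v + al)) 0 (2 * PI) = 0)
  by (intros; now apply RInt_cos_harmonic).
(* Of the two frequencies in the product, the sum [k + 2] is positive and integrates to 0; only the
   difference [k] remains. *)
assert (h2 : forall (k : nat) be al, RInt (fun v => cos (v + be) * cos (INR (S k) * v + al)) 0 (2 * PI) =
  / 2 * RInt (fun v => cos (INR k * v + (al - be))) 0 (2 * PI)).
{ intros k be al.
  rewrite (RInt_ext _ (fun v => / 2 * cos (INR (S (S k)) * v + (al + be)) + / 2 * cos (INR k * v + (al - be)))).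
  - rewrite RInt_add, !RInt_mul, (h (S (S k))) by (try lia; intros; cont); eqR; ring.
  - intros v _; eqR; rewrite !S_INR.
    replace ((INR k + 1 + 1) * v + (al + be)) with (((INR k + 1) * v + al) + (v + be)) by ring.
    replace (INR k * v + (al - be)) with (((INR k + 1) * v + al) - (v + be)) by ring.
    generalize ((INR k + 1) * v + al) (v + be); intros x y.
    rewrite cos_plus, cos_minus; field. }
assert (sc : forall v, sin v = cos (v + - (PI / 2))).
{ intros v; rewrite cos_plus, cos_neg, sin_neg, cos_PI2, sin_PI2; ring. }
exists p, q, s.
enough (Z : forall v, f v - (p + q * cos v + s * sin v) = 0) by (intros v; specialize (Z v); lra).
apply orthogonal_zero.
- intros; cont.
- intros t; rewrite pf, cos_plus, sin_plus, cos_2PI, sin_2PI; ring.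
- intros k al.
  rewrite (RInt_ext _ (fun v => f v * cos (INR k * v + al) - (p * cos (INR k * v + al) +
    (q * (cos (v + 0) * cos (INR k * v + al)) + s * (cos (v + - (PI / 2)) * cos (INR k * v + al)))))) by
    (intros v _; eqR; rewrite <- sc, Rplus_0_r; ring).
  rewrite RInt_sub, !RInt_add, !RInt_mul by (intros; cont).
  destruct k as [|[|k]].
  + rewrite (RInt_ext (fun v => f v * cos (INR 0 * v + al)) (fun v => cos al * f v)),
      (RInt_ext (fun v => cos (INR 0 * v + al)) (fun v => cos al)),
      (RInt_ext (fun v => cos (v + 0) * cos (INR 0 * v + al)) (fun v => cos al * cos (INR 1 * v + 0))),
      (RInt_ext (fun v => cos (v + - (PI / 2)) * cos (INR 0 * v + al)) (fun v => cos al * cos (INR 1 * v + - (PI / 2))))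
      by (intros; simpl INR; rewrite ?Rmult_0_l, ?Rmult_1_l, ?Rplus_0_l; eqR; ring).
    rewrite !RInt_mul, !h, RInt_cst by (try lia; intros; cont).
    unfold p; eqR; generalize (RInt f 0 (2 * PI)); intros I0; change R in I0; field; lra.
  + rewrite h, !h2 by lia.
    rewrite (RInt_ext (fun v => f v * cos (INR 1 * v + al)) (fun v => cos al * (f v * cos v) - sin al * (f v * sin v)))
      by (intros; simpl INR; rewrite Rmult_1_l, cos_plus; eqR; ring).
    rewrite RInt_sub, !RInt_mul by (intros; cont).
    rewrite !(RInt_ext (fun v => cos (INR 0 * v + _)) (fun v => cos _)) by (intros; simpl INR; now rewrite Rmult_0_l, Rplus_0_l).
    rewrite !RInt_cst.
    rewrite !Rminus_0_r; replace (al - - (PI / 2)) with (PI / 2 + al) by ring.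
    assert (E : cos (PI / 2 + al) = - sin al) by (rewrite cos_plus, cos_PI2, sin_PI2; ring).
    rewrite E; unfold q, s; eqR; generalize (RInt (fun v => f v * cos v) 0 (2 * PI)), (RInt (fun v => f v * sin v) 0 (2 * PI)).
    intros I1 I2; change R in I1, I2; field; lra.
  + rewrite h, !h2, !h by lia.
    rewrite (RInt_ext _ (fun v => f v * sin (INR (S (S k)) * v + (al + PI / 2)))).
    * rewrite H by lia; eqR; ring.
    * intros v _; f_equal; rewrite <- Rplus_assoc, (sin_plus _ (PI / 2)), cos_PI2, sin_PI2; ring.
Qed.

(** * Ellipses *)

Lemma unit_circle_angle (c s : R) : c ^ 2 + s ^ 2 = 1 -> exists t, cos t = c /\ sin t = s.
Proof.
intros E.
assert (B : -1 <= c <= 1) by nra.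
pose proof (cos_acos c B) as C; pose proof (sin_acos c B) as S.
assert (S2 : sqrt (1 - c²) * sqrt (1 - c²) = s * s).
{ rewrite sqrt_sqrt; unfold Rsqr; nra. }
pose proof (sqrt_pos (1 - c²)) as P.
destruct (Rle_dec 0 s) as [L|L].
- exists (acos c); split; [exact C|rewrite S; nra].
- exists (- acos c); rewrite cos_neg, sin_neg, S; split; [exact C|nra].
Qed.

(* The off-diagonal coefficient changes sign between the angles 0 and PI / 2. *)
Lemma diagonalize_form (p q s : R) : 0 < p -> 0 < p * s - q * q ->
  exists th l k, 0 < l /\ 0 < k /\ forall X Y,
    p * X ^ 2 + 2 * q * X * Y + s * Y ^ 2 =
    l * (cos th * X + sin th * Y) ^ 2 + k * (- sin th * X + cos th * Y) ^ 2.
Proof.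
intros Hp D.
destruct (continuous_zero_between
  (fun t => (s - p) * (sin t * cos t) + q * (cos t * cos t - sin t * sin t)) 0 (PI / 2)) as (th & _ & E).
- intros t; cont.
- rewrite cos_0, sin_0, cos_PI2, sin_PI2; nra.
- cbv beta in E; pose proof (sin2_cos2 th) as U; unfold Rsqr in U.
  set (c := cos th) in *; set (d := sin th) in *.
  exists th, (p * c ^ 2 + 2 * q * c * d + s * d ^ 2), (p * d ^ 2 - 2 * q * c * d + s * c ^ 2).
  assert (pos : forall z w, z * z + w * w = 1 -> 0 < p * z ^ 2 + 2 * q * z * w + s * w ^ 2).
  { intros z w H; apply Rmult_lt_reg_l with p; [exact Hp|].
    replace (p * (p * z ^ 2 + 2 * q * z * w + s * w ^ 2))
      with ((p * z + q * w) ^ 2 + (p * s - q * q) * (w * w)) by ring.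
    rewrite Rmult_0_r; pose proof (pow2_ge_0 (p * z + q * w)) as Q.
    destruct (Req_dec w 0) as [->|N].
    - assert (0 < (p * z) * (p * z)) by nra. nra.
    - assert (0 < w * w) by nra.
      assert (0 < (p * s - q * q) * (w * w)) by (now apply Rmult_lt_0_compat). lra. }
  split; [apply pos; lra|split; [specialize (pos (- d) c ltac:(lra)); nra|]].
  intros X Y; fold c d.
  set (u := c * X + d * Y); set (v := - d * X + c * Y).
  assert (EX : X = c * u - d * v) by (unfold u, v; replace (c * (c * X + d * Y) - d * (- d * X + c * Y))
    with ((d * d + c * c) * X) by ring; rewrite U; ring).
  assert (EY : Y = d * u + c * v) by (unfold u, v; replace (d * (c * X + d * Y) + c * (- d * X + c * Y))
    with ((d * d + c * c) * Y) by ring; rewrite U; ring).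
  rewrite EX, EY.
  replace (p * (c * u - d * v) ^ 2 + 2 * q * (c * u - d * v) * (d * u + c * v) + s * (d * u + c * v) ^ 2)
    with ((p * c ^ 2 + 2 * q * c * d + s * d ^ 2) * u ^ 2 + (p * d ^ 2 - 2 * q * c * d + s * c ^ 2) * v ^ 2
      + 2 * ((s - p) * (d * c) + q * (c * c - d * d)) * u * v) by ring.
  rewrite E; ring.
Qed.

(** Solving for [cos t] and [sin t] gives the equation [(x / r) ^ 2 + ((y - q * (x / r)) / s) ^ 2 =
    1], a quadratic form of determinant [/ (r * r * (s * s))]. The semi-axes are the inverse square
    roots of its diagonal coefficients after rotation. *)
Lemma affine_circle_is_ellipse (g : point -> Prop) (m r p q s : R) : 0 < r -> s <> 0 ->
  (forall P, g P <-> exists t, (m + r * cos t, p + q * cos t + s * sin t) = P) -> is_ellipse g.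
Proof.
intros Hr Hs Hg.
assert (s2 : 0 < s * s) by nra.
assert (r2 : 0 < r * r) by nra.
destruct (diagonalize_form (/ (r * r) + q * q / (r * r * (s * s))) (- q / (r * (s * s))) (/ (s * s)))
  as (th & l & k & Hl & Hk & E).
- apply Rplus_lt_le_0_compat; [now apply Rinv_0_lt_compat|].
  apply Rdiv_le_0_compat; [nra|now apply Rmult_lt_0_compat].
- replace (_ - _) with (/ (r * r * (s * s))) by (field; lra).
  apply Rinv_0_lt_compat; now apply Rmult_lt_0_compat.
- exists (m, p), th, (/ sqrt l), (/ sqrt k).
  assert (l0 : 0 < sqrt l) by now apply sqrt_lt_R0.
  assert (k0 : 0 < sqrt k) by now apply sqrt_lt_R0.
  split; [now apply Rinv_0_lt_compat|split; [now apply Rinv_0_lt_compat|]].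
  intros [X Y]; unfold vec; cbn [fst snd].
  set (x := X - m); set (y := Y - p).
  replace (((cos th * x + sin th * y) / / sqrt l) ^ 2 + ((- sin th * x + cos th * y) / / sqrt k) ^ 2)
    with ((x / r) ^ 2 + ((y - q * (x / r)) / s) ^ 2).
  + rewrite Hg; split.
    * intros [t Et]; injection Et as E1 E2.
      replace (x / r) with (cos t) by (unfold x; rewrite <- E1; field; lra).
      replace ((y - q * cos t) / s) with (sin t) by (unfold y; rewrite <- E2; field; lra).
      pose proof (sin2_cos2 t) as U; unfold Rsqr in U; lra.
    * intros H; destruct (unit_circle_angle _ _ H) as (t & E1 & E2).
      exists t; rewrite E1, E2; unfold x, y; f_equal; field; lra.
  + transitivity (l * (cos th * x + sin th * y) ^ 2 + k * (- sin th * x + cos th * y) ^ 2).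
    * rewrite <- E; field; lra.
    * rewrite <- (sqrt_sqrt l) at 1 by lra; rewrite <- (sqrt_sqrt k) at 1 by lra.
      field; lra.
Qed.

(** * Exact maximal areas for an ellipse *)

Lemma sin_le_tangent (h x : R) : 0 <= h <= PI / 2 -> 0 <= x <= 2 * PI ->
  sin x <= sin h + cos h * (x - h).
Proof.
intros Hh Hx; pose proof PI_RGT_0 as pi0.
assert (ch : 0 <= cos h) by (apply cos_ge_0; lra).
destruct (Rle_dec x PI) as [L|L].
- set (F := fun t => sin h + cos h * (t - h) - sin t).
  assert (DF : forall t, is_derive F t (cos h - cos t)).
  { intros t; unfold F; evar_last; [deriv|ring]. }
  destruct (MVT_gen F h x (fun t => cos h - cos t)) as (z & Hz & E).
  + intros; apply DF.
  + intros t _; apply continuity_pt_filterlim, (ex_derive_continuous F); eexists; apply DF.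
  + assert (F0 : F h = 0) by (unfold F; ring).
    rewrite F0 in E; unfold F in E.
    enough (0 <= (cos h - cos z) * (x - h)) by lra.
    unfold Rmin, Rmax in Hz; destruct (Rle_dec h x).
    * assert (cos z <= cos h).
      { destruct (Req_dec h z) as [->|]; [lra|apply Rlt_le, cos_decreasing_1; lra]. }
      nra.
    * assert (cos h <= cos z).
      { destruct (Req_dec h z) as [->|]; [lra|apply Rlt_le, cos_decreasing_1; lra]. }
      nra.
(* Beyond [PI] concavity is lost, but the tangent line has slope [cos h >= 0] and stays nonnegative.
   With [h = 2 * PI / n], this is where [4 <= n] comes from. *)
- assert (sin x <= 0) by (apply sin_le_0; lra).
  assert (0 <= sin h) by (apply sin_ge_0; lra).
  nra.
Qed.

(** [central_taylor] at 0 for the sine itself, an odd function, divided by 2. *)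
Lemma sin_cubic_bound (h : R) : 0 <= h -> Rabs (sin h - (h - h ^ 3 / 6)) <= h ^ 4.
Proof.
intros Hh.
pose proof (central_taylor sin cos (fun t => - sin t) (fun t => - cos t) sin 1 0) as T.
assert (B := T ltac:(lra) ltac:(intros; apply is_derive_sin) ltac:(intros; apply is_derive_cos)
  ltac:(intros; apply is_derive_Ropp, is_derive_sin)
  ltac:(intros; evar_last; [apply is_derive_Ropp, is_derive_cos|ring])
  ltac:(intros; apply Rabs_le, SIN_bound) h Hh).
rewrite Rminus_0_l, Rplus_0_l, sin_neg, cos_0 in B.
apply Rabs_le_between in B; apply Rabs_le_between; lra.
Qed.

Lemma expansion_coefficients (A a : nat -> R) (S K C : R) : even_asymptotic_expansion A a ->
  (forall n, (4 <= n)%nat -> Rabs (A n - (S - K / INR n ^ 2)) <= C / INR n ^ 3) ->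
  a 0%nat = S /\ a 1%nat = - K.
Proof.
intros Ha B; destruct (expansion_limits A a Ha) as [L0 L1].
assert (M0 : is_lim_seq A S).
{ apply (is_lim_seq_le_le_loc (fun n => S - K / INR n ^ 2 - C / INR n ^ 3) A
    (fun n => S - K / INR n ^ 2 + C / INR n ^ 3)).
  - exists 4%nat; intros n Hn; specialize (B n Hn); apply Rabs_le_between in B; lra.
  - replace (Finite S) with (Finite (S - 0 - 0)) by (f_equal; ring).
    apply is_lim_seq_minus'; [apply is_lim_seq_minus'|]; auto using is_lim_seq_const, is_lim_seq_div_pow.
  - replace (Finite S) with (Finite (S - 0 + 0)) by (f_equal; ring).
    apply is_lim_seq_plus'; [apply is_lim_seq_minus'|]; auto using is_lim_seq_const, is_lim_seq_div_pow. }
assert (E0 : a 0%nat = S).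
{ apply is_lim_seq_unique in L0; apply is_lim_seq_unique in M0; rewrite M0 in L0; congruence. }
split; [exact E0|].
assert (M1 : is_lim_seq (fun n => INR n ^ 2 * (A n - a 0%nat)) (- K)).
{ rewrite E0.
  apply (is_lim_seq_le_le_loc (fun n => - K - C / INR n ^ 1) _ (fun n => - K + C / INR n ^ 1)).
  - exists 4%nat; intros n Hn; specialize (B n Hn); apply Rabs_le_between in B.
    assert (n0 : 0 < INR n) by (apply lt_0_INR; lia).
    assert (n2 : 0 <= INR n ^ 2) by (apply pow_le; lra).
    replace (- K - C / INR n ^ 1) with (INR n ^ 2 * (- (K / INR n ^ 2) - C / INR n ^ 3)) by (field; lra).
    replace (- K + C / INR n ^ 1) with (INR n ^ 2 * (- (K / INR n ^ 2) + C / INR n ^ 3)) by (field; lra).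
    split; apply Rmult_le_compat_l; lra.
  - replace (Finite (- K)) with (Finite (- K - 0)) by (f_equal; ring).
    apply is_lim_seq_minus'; auto using is_lim_seq_const, is_lim_seq_div_pow.
  - replace (Finite (- K)) with (Finite (- K + 0)) by (f_equal; ring).
    apply is_lim_seq_plus'; auto using is_lim_seq_const, is_lim_seq_div_pow. }
apply is_lim_seq_unique in L1; apply is_lim_seq_unique in M1; rewrite M1 in L1; congruence.
Qed.

Lemma is_ellipse_parametrization (g : point -> Prop) : is_ellipse g ->
  exists m1 m2 th a b, 0 < a /\ 0 < b /\
    forall p, g p <-> exists t, (m1 + (a * cos th * cos t - b * sin th * sin t),
                                 m2 + (a * sin th * cos t + b * cos th * sin t)) = p.
Proof.
intros ([m1 m2] & th & a & b & Ha & Hb & H).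
exists m1, m2, th, a, b; split; [exact Ha|split; [exact Hb|]].
pose proof (sin2_cos2 th) as U; unfold Rsqr in U.
intros [X Y]; rewrite H; unfold vec; cbn [fst snd]; split.
- intros E; destruct (unit_circle_angle _ _ E) as (t & E1 & E2).
  exists t.
  assert (F1 : a * cos t = cos th * (X - m1) + sin th * (Y - m2)) by (rewrite E1; field; lra).
  assert (F2 : b * sin t = - sin th * (X - m1) + cos th * (Y - m2)) by (rewrite E2; field; lra).
  f_equal.
  + replace (a * cos th * cos t - b * sin th * sin t) with (cos th * (a * cos t) - sin th * (b * sin t)) by ring.
    rewrite F1, F2.
    replace (m1 + _) with (m1 + (sin th * sin th + cos th * cos th) * (X - m1)) by ring.
    rewrite U; ring.
  + replace (a * sin th * cos t + b * cos th * sin t) with (sin th * (a * cos t) + cos th * (b * sin t)) by ring.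
    rewrite F1, F2.
    replace (m2 + _) with (m2 + (sin th * sin th + cos th * cos th) * (Y - m2)) by ring.
    rewrite U; ring.
- intros [t E]; injection E as E1 E2; rewrite <- E1, <- E2.
  replace (_ / a) with ((sin th * sin th + cos th * cos th) * cos t) by (field; lra).
  replace (_ / b) with ((sin th * sin th + cos th * cos th) * sin t) by (field; lra).
  rewrite U; pose proof (sin2_cos2 t) as V; unfold Rsqr in V; lra.
Qed.

Section Ellipse.
Variables (g : point -> Prop) (m1 m2 th a b : R).
Hypothesis Ha : 0 < a.
Hypothesis Hb : 0 < b.
Let E t : point := (m1 + (a * cos th * cos t - b * sin th * sin t),
                    m2 + (a * sin th * cos t + b * cos th * sin t)).
Hypothesis Hg : forall p, g p <-> exists t, E t = p.

(** The linear part of the parametrization has determinant [a * b], and the centre contributes only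
    a difference, which cancels around a closed polygon. *)
Lemma ellipse_cross (s t : R) :
  cross (E s) (E t) = a * b * sin (t - s) + cross (m1, m2) (E t) - cross (m1, m2) (E s).
Proof.
pose proof (sin2_cos2 th) as U; unfold Rsqr in U.
replace (a * b) with (a * b * (sin th * sin th + cos th * cos th)) by (rewrite U; ring).
rewrite sin_minus; unfold E, cross; cbn [fst snd]; ring.
Qed.

Lemma ellipse_orient (r s t : R) : r < s -> s < t -> t < r + 2 * PI -> 0 < orient (E r) (E s) (E t).
Proof.
intros H1 H2 H3.
assert (EO : orient (E r) (E s) (E t) = cross (E r) (E s) + cross (E s) (E t) - cross (E r) (E t))
  by (unfold orient, cross, vec; cbn [fst snd]; ring).
rewrite EO, !ellipse_cross.
set (x := (s - r) / 2); set (y := (t - s) / 2).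
replace (s - r) with (2 * x) by (unfold x; field).
replace (t - s) with (2 * y) by (unfold y; field).
replace (t - r) with (2 * x + 2 * y) by (unfold x, y; field).
(* [sin (2 * x) + sin (2 * y) - sin (2 * x + 2 * y) = 4 * sin x * sin y * sin (x + y)], and all
   three half-angles lie between 0 and [PI]. *)
replace (_ - _) with (4 * (a * b) * (sin x * sin y * sin (x + y))).
- pose proof PI_RGT_0.
  repeat apply Rmult_lt_0_compat; try lra; apply sin_gt_0; unfold x, y; lra.
- rewrite (sin_plus (2 * x)), !sin_2a, !cos_2a, sin_plus.
  pose proof (sin2_cos2 x) as U; pose proof (sin2_cos2 y) as V; unfold Rsqr in U, V.
  replace (cos x * cos x) with (1 - sin x * sin x) by lra.
  replace (cos y * cos y) with (1 - sin y * sin y) by lra.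
  ring_simplify.
  replace (cos y ^ 2) with (1 - sin y ^ 2) by lra.
  replace (cos x ^ 2) with (1 - sin x ^ 2) by lra. ring.
Qed.

Lemma ellipse_oval : oval E (2 * PI).
Proof.
pose proof PI_RGT_0.
split; [lra|split; [|split; [|split]]].
- intros t; unfold E; cbn [fst]; cont.
- intros t; unfold E; cbn [snd]; cont.
- intros t; unfold E; now rewrite cos_plus, sin_plus, cos_2PI, sin_2PI, !Rmult_0_r, !Rmult_1_r, Rminus_0_r, Rplus_0_r.
- intros r s t H1 H2 H3; apply Rgt_not_eq; now apply ellipse_orient.
Qed.

(* The tangent line of [sin] at [2 PI / n] bounds the sum of the sines of the gaps. *)
Lemma ellipse_max_area (n : nat) (B : R) : (4 <= n)%nat -> is_max_inscribed_area g n B ->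
  B = INR n / 2 * (a * b) * sin (2 * PI / INR n).
Proof.
intros Hn HB; pose proof PI_RGT_0 as pi0.
assert (n4 : 4 <= INR n) by (replace 4 with (INR 4) by (simpl; ring); now apply le_INR).
set (h := 2 * PI / INR n).
assert (nh : INR n * h = 2 * PI) by (unfold h; field; lra).
assert (h0 : 0 <= h <= PI / 2).
{ assert (0 <= h) by (apply Rdiv_le_0_compat; lra); nra. }
apply Rle_antisym.
- destruct HB as [(v & Sv & Iv & <-) _].
  replace (INR n / 2 * (a * b) * sin h) with
    ((a * b * cos h * (2 * PI) + INR n * (a * b * (sin h - cos h * h))) / 2)
    by (rewrite <- nh; field).
  (* The potential joins the slope of the tangent line to the contribution of the centre. As
     [n * h = 2 * PI], the slope terms cancel in the total. *)
  apply (simple_polygon_area_le E (2 * PI) _ _ (fun t => a * b * cos h * t + cross (m1, m2) (E t))).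
  + exact ellipse_oval.
  + exact ellipse_orient.
  + intros t; destruct ellipse_oval as (_ & _ & _ & -> & _); ring.
  + intros s t H1 H2; rewrite ellipse_cross.
    pose proof (sin_le_tangent h (t - s) h0 ltac:(lra)) as L.
    assert (0 < a * b) by (now apply Rmult_lt_0_compat).
    assert (a * b * sin (t - s) <= a * b * (sin h + cos h * (t - s - h))) by (apply Rmult_le_compat_l; lra).
    lra.
  + lia.
  + exact Sv.
  + intros i Hi; now apply Hg, Iv.
- pose proof (max_area_ge_sum g n B E (2 * PI) 0 ltac:(lia) HB ellipse_oval
    (fun t => proj2 (Hg (E t)) (ex_intro _ t eq_refl))) as L.
  fold h in L.
  assert (tel : forall k, sum_n (fun i => cross (E (0 + INR i * h)) (E (0 + INR i * h + h))) k =
     INR (S k) * (a * b * sin h) + cross (m1, m2) (E (INR (S k) * h)) - cross (m1, m2) (E 0)).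
  { induction k as [|k IH]; eqR.
    - rewrite sum_O, ellipse_cross; simpl INR.
      replace (0 + 0 * h + h) with (1 * h) by ring; replace (0 + 0 * h) with 0 by ring.
      replace (1 * h - 0) with h by ring; ring.
    - rewrite sum_n_RS, IH, ellipse_cross.
      replace (0 + INR (S k) * h + h) with (INR (S (S k)) * h) by (rewrite (S_INR (S k)); ring).
      replace (0 + INR (S k) * h) with (INR (S k) * h) by ring.
      replace (INR (S (S k)) * h - INR (S k) * h) with h by (rewrite (S_INR (S k)); ring).
      rewrite (S_INR (S k)); ring. }
  rewrite tel in L; replace (S (pred n)) with n in L by lia.
  rewrite nh in L.
  destruct ellipse_oval as (_ & _ & _ & per & _).
  rewrite <- (Rplus_0_l (2 * PI)), per in L; lra.
Qed.

Lemma ellipse_equality (A c : nat -> R) :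
  (forall n, (3 <= n)%nat -> is_max_inscribed_area g n (A n)) ->
  even_asymptotic_expansion A c -> - 3 * c 1%nat = 2 * PI ^ 2 * c 0%nat.
Proof.
intros HA Hc; pose proof PI_RGT_0 as pi0.
(* With [h = 2 * PI / n], these come from multiplying [h], [h ^ 3 / 6] and the error [h ^ 4] by
   [n / 2 * (a * b)]. *)
destruct (expansion_coefficients A c (PI * (a * b)) (2 * PI ^ 3 * (a * b) / 3) (8 * PI ^ 4 * (a * b)) Hc)
  as [-> ->]; [|field].
intros n Hn; rewrite (ellipse_max_area n (A n) Hn (HA n ltac:(lia))).
assert (n0 : 0 < INR n) by (apply lt_0_INR; lia).
assert (h0 : 0 <= 2 * PI / INR n) by (apply Rdiv_le_0_compat; lra).
pose proof (sin_cubic_bound _ h0) as B.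
set (d := sin (2 * PI / INR n) - (2 * PI / INR n - (2 * PI / INR n) ^ 3 / 6)) in B.
replace (INR n / 2 * (a * b) * sin (2 * PI / INR n) - (PI * (a * b) - 2 * PI ^ 3 * (a * b) / 3 / INR n ^ 2))
  with (INR n / 2 * (a * b) * d) by (unfold d; field; lra).
assert (P : 0 <= INR n / 2 * (a * b)) by (apply Rmult_le_pos; [lra|apply Rlt_le; now apply Rmult_lt_0_compat]).
rewrite Rabs_mult, (Rabs_pos_eq _ P).
apply Rle_trans with (INR n / 2 * (a * b) * (2 * PI / INR n) ^ 4).
- now apply Rmult_le_compat_l.
- apply Req_le; field; lra.
Qed.
End Ellipse.

Theorem theorem6 (g : point -> Prop) (A a : nat -> R)
  (hg : smooth_strictly_convex_closed_curve g)
  (hA : forall n : nat, (3 <= n)%nat -> is_max_inscribed_area g n (A n))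
  (ha : even_asymptotic_expansion A a) :
  - 3 * a 1%nat <= 2 * PI ^ 2 * a 0%nat /\
  (- 3 * a 1%nat = 2 * PI ^ 2 * a 0%nat <-> is_ellipse g).
Proof.
destruct (sas_parametrization g hg) as (m & r & f & r0 & Cf & pf & Hg & ov & inj & up).
split; [|split].
- exact (proj2 (sas_inequality g m r f Cf pf Hg ov inj A a hA ha up)).
- intros E.
  destruct (first_harmonics f Cf pf) as (p & q & s & F).
  { intros k Hk al; exact (sine_coefficient_zero g m r f r0 Cf pf Hg ov inj A a hA ha up E k Hk al). }
  apply affine_circle_is_ellipse with m r p q s; [exact r0| |].
  (* If [s] were 0, the angles [PI / 2] and [3 * (PI / 2)] would give the same point. *)
  + intros s0; pose proof PI_RGT_0.
    apply (inj (PI / 2) (3 * (PI / 2))); [lra|lra|].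
    rewrite !F, cos_PI2, cos_3PI2, s0; f_equal; ring.
  + intros P; rewrite Hg; split; intros [t Et]; exists t; rewrite <- Et; now rewrite F.
- intros El; destruct (is_ellipse_parametrization g El) as (m1 & m2 & th & a' & b' & Ha & Hb & Hp).
  exact (ellipse_equality g m1 m2 th a' b' Ha Hb Hp A a hA ha).
Qed.
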